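(* Assume that $a\in C^1((0,\infty))$ is a positive function such that $a\notin L^1(1,\infty)$ and that, for each $\varepsilon\in(0,\infty)$, there is $\kappa_\varepsilon>0$ for which $$a(r)\le \varepsilon\, r\,a(r)+\frac{\kappa_\varepsilon}{r}\qquad\text{for all } r\in(0,1).$$ Let $M>0$, $m_0\in(0,M)$, and let $u_0\in C([0,1])$ satisfy $u_0\ge m_0>0$ and $\langle u_0\rangle=M$. Let $(u,v)$ be the corresponding maximal classical solution to the quasilinear Smoluchowski-Poisson system with diffusion coefficient $a$ and initial condition $u_0$, with maximal existence time $T_{max}\in(0,\infty]$. Then $T_{max}=\infty$ and the trajectory $\{(u(t),v(t)) : t\ge 0\}$ is bounded in $L^\infty(0,1;\mathbb{R}^2)$. In addition, if $a\notin L^1(0,1)$, there is $\mu>0$ such that $u(t,x)\ge\mu$ for all $(t,x)\in[0,\infty)\times[0,1]$.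
   Context: For an integrable function $g$ on a bounded interval $I$, $\langle g\rangle:=\frac{1}{|I|}\int_I g(x)\,dx$. Given a positive $a\in C^1((0,\infty))$ with indefinite integral $A$ (i.e. $A'=a$) and $u_0\in C([0,1])$ with $M=\langle u_0\rangle$, the one-dimensional quasilinear Smoluchowski-Poisson system on $(0,T)\times(0,1)$ is $$\partial_t u=\partial_x\big(a(u)\,\partial_x u-u\,\partial_x v\big),\qquad 0=\partial_x^2 v+u-M\quad\text{in }(0,T)\times(0,1),$$ $$\partial_x A(u)(t,0)=\partial_x A(u)(t,1)=\partial_x v(t,0)=\partial_x v(t,1)=0\quad\text{for } t\in(0,T),$$ $$u(0)=u_0\ \text{ in }(0,1),\qquad \langle v(t)\rangle=0\ \text{ for } t\in(0,T).$$ When $u_0\ge m_0>0$ with $m_0\in(0,M)$, the corresponding maximal classical solution is the unique pair $(u,v)\in C([0,T_{max})\times[0,1];\mathbb{R}^2)\cap C^{1,2}((0,T_{max})\times[0,1];\mathbb{R}^2)$ solving the system on $[0,T_{max})$, with $\langle u(t)\rangle=M$ and $u(t,x)\ge \frac{Mm_0}{m_0+e^{Mt}(M-m_0)}>0$ for all $(t,x)\in[0,T_{max})\times[0,1]$, where $T_{max}\in(0,\infty]$ is the maximal existence time: if $T_{max}<\infty$, then $\|u(t)\|_{L^\infty(0,1)}\to\infty$ as $t\to T_{max}$. Here $C^{1,2}$ means continuously differentiable once in time $t$ and twice in space $x$. *)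

(* Defs.v *)
From HB Require Import structures.
From mathcomp Require Import all_boot all_order all_algebra.
From mathcomp Require Import all_classical all_reals all_analysis.
Set Implicit Arguments.
Unset Strict Implicit.
Unset Printing Implicit Defensive.
Import Order.TTheory GRing.Theory Num.Theory.
Import numFieldNormedType.Exports.
Local Open Scope classical_set_scope.
Local Open Scope ring_scope.

Definition mean (R : realType) (c d : R) (g : R -> R) : R :=
  (d - c)^-1 * \int[lebesgue_measure]_(x in `[c, d]) g x.

Definition L1_on (R : realType) (D : set R) (f : R -> R) : Prop :=
  lebesgue_measure.-integrable D (EFin \o f).

Definition Linf01 (R : realType) (V : normedModType R) (f : R -> V) : \bar R :=
  ('N[lebesgue_measure]_(+oo) [ (fun x => (`|f x|)%:E) \_ `]0%R, 1%R[ ])%E.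

(* Differentiation relative to [0, 1]: the derivative is one-sided at 0 and 1,
   so that space derivatives make sense up to the boundary. *)
Definition diff_quot (R : realType) (f : R -> R) (x y : R) : R :=
  (f y - f x) / (y - x).

Definition derivable01 (R : realType) (f : R -> R) (x : R) : Prop :=
  cvg (diff_quot f x y @[y --> within `[0, 1] x^']).

Definition derive01 (R : realType) (f : R -> R) (x : R) : R :=
  lim (diff_quot f x y @[y --> within `[0, 1] x^']).

Definition C1_pos (R : realType) (a : R -> R) : Prop :=
  forall r : R, 0 < r -> derivable a r 1 /\ {for r, continuous (derive1 a)}.

(* [0, T) x [0, 1] and (0, T) x [0, 1], time coordinate first *)
Definition cyl (R : realType) (T : \bar R) : set (R * R) :=
  [set p | [/\ 0 <= p.1, (p.1%:E < T)%E & 0 <= p.2 <= 1]].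

Definition cyl_pos (R : realType) (T : \bar R) : set (R * R) :=
  [set p | [/\ 0 < p.1, (p.1%:E < T)%E & 0 <= p.2 <= 1]].

Definition continuous_on2 (R : realType) (D : set (R * R)) (w : R -> R -> R)
    : Prop :=
  {within D, continuous (fun p : R * R => w p.1 p.2)}.

Definition dt (R : realType) (w : R -> R -> R) (t x : R) : R :=
  derive1 (w^~ x) t.

Definition dx (R : realType) (w : R -> R -> R) (t x : R) : R :=
  derive01 (w t) x.

Definition C12 (R : realType) (T : \bar R) (w : R -> R -> R) : Prop :=
  [/\ forall t x, cyl_pos T (t, x) ->
        [/\ derivable (w^~ x) t 1, derivable01 (w t) x
          & derivable01 (dx w t) x],
      continuous_on2 (cyl_pos T) w,
      continuous_on2 (cyl_pos T) (dt w),
      continuous_on2 (cyl_pos T) (dx w)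
    & continuous_on2 (cyl_pos T) (dx (dx w))].

Record classical_solution (R : realType) (a A u0 : R -> R) (M : R)
    (T : \bar R) (u v : R -> R -> R) : Prop := ClassicalSolution {
  sol_cont_u : continuous_on2 (cyl T) u ;
  sol_cont_v : continuous_on2 (cyl T) v ;
  sol_C12_u : C12 T u ;
  sol_C12_v : C12 T v ;
  sol_eq_u : forall t x, 0 < t -> (t%:E < T)%E -> 0 < x < 1 ->
    dt u t x = dx (fun s y => a (u s y) * dx u s y - u s y * dx v s y) t x ;
  sol_eq_v : forall t x, 0 < t -> (t%:E < T)%E -> 0 < x < 1 ->
    0 = dx (dx v) t x + u t x - M ;
  sol_bc_u : forall t, 0 < t -> (t%:E < T)%E ->
    dx (fun s y => A (u s y)) t 0 = 0 /\ dx (fun s y => A (u s y)) t 1 = 0 ;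
  sol_bc_v : forall t, 0 < t -> (t%:E < T)%E ->
    dx v t 0 = 0 /\ dx v t 1 = 0 ;
  sol_init : forall x, 0 < x < 1 -> u 0 x = u0 x ;
  sol_mean_v : forall t, 0 < t -> (t%:E < T)%E -> mean 0 1 (v t) = 0
}.

(* The blow-up alternative is what makes T the maximal existence time. *)
Record maximal_classical_solution (R : realType) (a A u0 : R -> R) (M m0 : R)
    (T : \bar R) (u v : R -> R -> R) : Prop := MaximalClassicalSolution {
  max_T_gt0 : (0 < T)%E ;
  max_sol : classical_solution a A u0 M T u v ;
  max_mass : forall t, 0 <= t -> (t%:E < T)%E -> mean 0 1 (u t) = M ;
  max_lower : forall t x, cyl T (t, x) ->
    M * m0 / (m0 + expR (M * t) * (M - m0)) <= u t x ;
  max_blowup : forall T0 : R, T = T0%:E ->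
    Linf01 (u t) @[t --> T0^'-] --> +oo%E
}.

(* Main.v *)
Require Import Defs.
From HB Require Import structures.
From mathcomp Require Import all_boot all_order all_algebra.
From mathcomp Require Import all_classical all_reals all_analysis.
From mathcomp Require Import measurable_realfun ess_sup_inf ring lra.
Set Implicit Arguments.
Unset Strict Implicit.
Unset Printing Implicit Defensive.
Import Order.TTheory GRing.Theory Num.Theory.
Import numFieldNormedType.Exports.
Local Open Scope classical_set_scope.
Local Open Scope ring_scope.

(* The cumulative mass [U t x := M x - dx v t x] satisfies [dx U = u],
   [U t 0 = 0], [U t 1 = M] and
     [dt U = a (dx U) dx (dx U) - (M x - U) dx U],
   a quasilinear equation whose first-order term is at most [M * dx U] in
   absolute value.  For such equations the gradient is controlled by the
   oscillation of [U], which is [M], as soon as [a] is not integrable at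
   infinity (Nagumo's condition).  Concretely, let [p] solve [a(p) p' = - C] on
   [0, M] with [C > M] and let [G' = 1 / p], [G 0 = 0]; doubling the space
   variable and applying the maximum principle to
   [G (U t x - U t y) - (x - y)], [y <= x], shows that this quantity stays
   nonpositive, and letting [x] tend to [y] gives [u <= p 0].  Nonintegrability
   of [a] is exactly what allows [p] to stay above the initial bound of [u]
   along the whole of [0, M].  Reversing all signs gives the lower bound when
   [a] is not integrable at [0]. *)

(** * One-sided differentiation on [0, 1] *)

(** Makes limits along this filter unique, so that [derive01] is determined by any limit of the
    difference quotient. Nearby points are taken to the right of [x] if [x < 1], to the left
    otherwise. *)
Lemma within01_proper (R : realType) (x : R) : 0 <= x <= 1 ->
  ProperFilter (within `[0, 1] x^').
Proof.
move=> /andP[x0 x1]; apply: Build_ProperFilter_ex => P.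
rewrite /within /= => /nbhs_ballP[e /= e0 Pe].
have [xlt|xge] := ltP x 1.
- exists (x + Num.min (e / 2) (1 - x)).
  have h1 : 0 < Num.min (e / 2) (1 - x) by rewrite lt_min; apply/andP; split; lra.
  have h2 : Num.min (e / 2) (1 - x) <= e / 2 by rewrite ge_min lexx.
  have h3 : Num.min (e / 2) (1 - x) <= 1 - x by rewrite ge_min lexx orbT.
  apply: Pe; last by rewrite /= in_itv /=; apply/andP; split; lra.
    by rewrite /ball /= opprD addNKr normrN gtr0_norm//; lra.
  by apply/eqP => h; lra.
- exists (x - Num.min (e / 2) x).
  have h1 : 0 < Num.min (e / 2) x by rewrite lt_min; apply/andP; split; lra.
  have h2 : Num.min (e / 2) x <= e / 2 by rewrite ge_min lexx.
  have h3 : Num.min (e / 2) x <= x by rewrite ge_min lexx orbT.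
  apply: Pe; last by rewrite /= in_itv /=; apply/andP; split; lra.
    by rewrite /ball /= opprB addrC subrK gtr0_norm//; lra.
  by apply/eqP => h; lra.
Qed.

Lemma diff_quot_errE (R : realType) (f : R -> R) (x y l : R) : y != x ->
  `|f y - f x - l * (y - x)| = `|l - diff_quot f x y| * `|y - x|.
Proof.
move=> yx; rewrite -normrM distrC; congr (`| _ |).
by rewrite /diff_quot mulrBl divfK// subr_eq0.
Qed.

(** With the denominator cleared, [y = x] is allowed (both sides vanish there), and increment
    estimates can be added and composed directly. *)
Lemma diff_quot_cvgP (R : realType) (f : R -> R) (D : set R) (x l : R) :
  diff_quot f x y @[y --> within D x^'] --> l <->
  forall e, 0 < e -> exists2 d, 0 < d &
    forall y, D y -> `|y - x| < d -> `|f y - f x - l * (y - x)| <= e * `|y - x|.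
Proof.
split => [fl e e0|H].
- have /cvgrPdist_le/(_ e e0) := fl.
  rewrite /within /= => /nbhs_ballP[d /= d0 Hd]; exists d => // y Dy yd.
  have [->|yx] := eqVneq y x; first by rewrite !subrr mulr0 subrr !normr0 mulr0.
  rewrite diff_quot_errE//; apply: ler_wpM2r => //.
  by apply: Hd => //; rewrite /ball /= distrC.
- apply/cvgrPdist_le => e e0; have [d d0 Hd] := H e e0.
  rewrite /within /=; apply/nbhs_ballP; exists d => //= y yd yx Dy.
  have yd' : `|y - x| < d by rewrite distrC.
  have := Hd y Dy yd'; rewrite diff_quot_errE//.
  by rewrite ler_pM2r// normr_gt0 subr_eq0.
Qed.

Lemma is_derive1P (R : realType) (f : R -> R) (x l : R) :
  is_derive x 1 f l <->
  forall e, 0 < e -> exists2 d, 0 < d &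
    forall y, `|y - x| < d -> `|f y - f x - l * (y - x)| <= e * `|y - x|.
Proof.
have E h : h != 0 -> h^-1 *: ((f \o shift x) (h *: 1) - f x) =
    diff_quot f x (h + x).
  by move=> h0; rewrite /diff_quot /= addrK /GRing.scale /= mulr1 mulrC.
split => [[df <-] e e0|H].
- have /cvgrPdist_le/(_ e e0) := df.
  rewrite /dnbhs /within /= => /nbhs_ballP[d /= d0 Hd]; exists d => // y yd.
  have [->|yx] := eqVneq y x; first by rewrite !subrr mulr0 subrr !normr0 mulr0.
  rewrite diff_quot_errE//; apply: ler_wpM2r => //.
  have := Hd (y - x); rewrite /ball /= sub0r normrN => /(_ yd).
  rewrite subr_eq0 => /(_ yx); have := E (y - x).
  by rewrite subr_eq0 /= => /(_ yx) ->; rewrite subrK.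
- have df : h^-1 *: ((f \o shift x) (h *: 1) - f x) @[h --> 0^'] --> l.
    apply/cvgrPdist_le => e e0; have [d d0 Hd] := H e e0.
    rewrite /dnbhs /within /=; apply/nbhs_ballP; exists d => //= h hd h0.
    have := E h h0; rewrite /= => ->.
    have hx : h + x != x by rewrite -subr_eq0 addrK.
    move: hd; rewrite /ball /= sub0r normrN => hd.
    have := Hd (h + x); rewrite diff_quot_errE// addrK => /(_ hd).
    by rewrite ler_pM2r// normr_gt0.
  by split; [apply/cvg_ex; exists l|exact: cvg_lim].
Qed.

(** Increment form of the derivative relative to [0, 1]: one-sided at the end points, the usual
    derivative inside. *)
Definition is_derive01 (R : realType) (f : R -> R) (x l : R) :=
  forall e, 0 < e -> exists2 d, 0 < d & forall y, 0 <= y <= 1 ->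
    `|y - x| < d -> `|f y - f x - l * (y - x)| <= e * `|y - x|.

Lemma derivable01P (R : realType) (f : R -> R) (x : R) :
  derivable01 f x -> is_derive01 f x (derive01 f x).
Proof.
by move=> /diff_quot_cvgP H e /H.
Qed.

Lemma is_derive01_val (R : realType) (f : R -> R) (x l : R) : 0 <= x <= 1 ->
  is_derive01 f x l -> derive01 f x = l.
Proof.
move=> x01 H; have := within01_proper x01 => pf; apply: cvg_lim => //.
by apply/diff_quot_cvgP => e /H.
Qed.

Lemma is_derive_is_derive01 (R : realType) (f : R -> R) (x l : R) :
  is_derive x 1 f l -> is_derive01 f x l.
Proof.
by move=> /is_derive1P H e /H[d d0 Hd]; exists d => // y _; exact: Hd.
Qed.

Lemma is_derive01_is_derive (R : realType) (f : R -> R) (x l : R) :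
  0 < x < 1 -> is_derive01 f x l -> is_derive x 1 f l.
Proof.
move=> /andP[x0 x1] H; apply/is_derive1P => e /H[d d0 Hd].
exists (Num.min d (Num.min x (1 - x))).
  by rewrite !lt_min d0 x0 subr_gt0 x1.
move=> y; rewrite !lt_min => /and3P[yd yx yx1]; apply: Hd => //.
by move: yx yx1; rewrite !ltr_norml => /andP[? ?] /andP[? ?]; apply/andP; split; lra.
Qed.

Lemma is_derive01_continuous (R : realType) (f : R -> R) (x l : R) :
  is_derive01 f x l -> forall e, 0 < e -> exists2 d, 0 < d &
    forall y, 0 <= y <= 1 -> `|y - x| < d -> `|f y - f x| < e.
Proof.
move=> H e e0; have [d d0 Hd] := H 1 ltr01.
have l1 : 0 < `|l| + 1 by rewrite ltr_wpDl.
exists (Num.min d (e / (`|l| + 1))).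
  by rewrite lt_min d0 divr_gt0.
move=> y y01; rewrite lt_min => /andP[yd]; rewrite ltr_pdivlMr// => ye.
have := Hd y y01 yd; rewrite mul1r => Hy.
rewrite (_ : f y - f x = (f y - f x - l * (y - x)) + l * (y - x)); last by ring.
apply: le_lt_trans (ler_normD _ _) _; rewrite normrM; apply: le_lt_trans ye.
by rewrite [leRHS]mulrC mulrDl mul1r addrC lerD2l.
Qed.

Lemma is_derive01_within_continuous (R : realType) (f df : R -> R) :
  (forall x, 0 <= x <= 1 -> is_derive01 f x (df x)) ->
  {within `[0, 1], continuous f}.
Proof.
move=> H; apply/subspace_continuousP => x; rewrite /= in_itv /= => x01.
apply/cvgrPdist_lt => e e0.
have [d d0 Hd] := is_derive01_continuous (H x x01) e0.
rewrite /within /=; apply/nbhs_ballP; exists d => //= y.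
rewrite /ball /= in_itv /= distrC => yd y01; rewrite distrC; exact: Hd.
Qed.

(** Chain rule valid up to the boundary, where the condition on [A(u)] is imposed. The error splits
    into that of [A] along [f] and [a] times that of [f]; each receives half of [e]. *)
Lemma is_derive01_comp (R : realType) (A f : R -> R) (x a l : R) :
  is_derive (f x) 1 A a -> is_derive01 f x l ->
  is_derive01 (A \o f) x (a * l).
Proof.
move=> dA df e e0; have l1 : 0 < `|l| + 1 by rewrite ltr_wpDl.
have a1 : 0 < `|a| + 1 by rewrite ltr_wpDl.
have e1 : 0 < e / 2 / (`|l| + 1) by rewrite !divr_gt0.
have e2 : 0 < e / 2 / (`|a| + 1) by rewrite !divr_gt0.
have /is_derive1P/(_ _ e1)[d1 d10 H1] := dA.
have [d2 d20 H2] := is_derive01_continuous df d10.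
have [d3 d30 H3] := df _ e2.
have [d4 d40 H4] := df 1 ltr01.
exists (Num.min d2 (Num.min d3 d4)); first by rewrite !lt_min d20 d30.
move=> y y01; rewrite !lt_min => /and3P[y2 y3 y4] /=.
have {}H1 := H1 _ (H2 _ y01 y2).
have {}H3 := H3 _ y01 y3; have {}H4 := H4 _ y01 y4.
have fy : `|f y - f x| <= (`|l| + 1) * `|y - x|.
  rewrite (_ : f y - f x = (f y - f x - l * (y - x)) + l * (y - x)); last by ring.
  by apply: le_trans (ler_normD _ _) _; rewrite normrM addrC mulrDl lerD2l.
rewrite (_ : A (f y) - A (f x) - a * l * (y - x) =
  (A (f y) - A (f x) - a * (f y - f x)) + a * (f y - f x - l * (y - x))); last by ring.
apply: le_trans (ler_normD _ _) _; rewrite normrM.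
have {H1 fy} : `|A (f y) - A (f x) - a * (f y - f x)| <= e / 2 * `|y - x|.
  apply: le_trans H1 _; apply: le_trans (ler_wpM2l (ltW e1) fy) _.
  by rewrite mulrA divfK// gt_eqF.
have : `|a| * `|f y - f x - l * (y - x)| <= e / 2 * `|y - x|.
  apply: le_trans (_ : (`|a| + 1) * (e / 2 / (`|a| + 1) * `|y - x|) <= _).
    by apply: ler_pM => //; rewrite lerDl.
  by rewrite mulrA mulrCA divff ?mulr1// gt_eqF.
by move=> h1 h2; have := lerD h2 h1; rewrite -mulrDl -splitr.
Qed.

(** * First- and second-order conditions at a maximum *)

(** Only points to the left of [t] are compared, since a maximum in time may sit at the final time.
    If [l < 0], a small step back would increase [f]. *)
Lemma derive_left_max_ge0 (R : realType) (f : R -> R) (s t l : R) : s < t ->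
  is_derive t 1 f l -> (forall r, s <= r <= t -> f r <= f t) -> 0 <= l.
Proof.
move=> st /is_derive1P H fm; rewrite leNgt; apply/negP => l0.
have e0 : 0 < - l / 2 by lra.
have [d d0 Hd] := H _ e0.
pose h := Num.min (d / 2) (t - s).
have h0 : 0 < h by rewrite lt_min; apply/andP; split; lra.
have h1 : h <= d / 2 by rewrite ge_min lexx.
have h2 : h <= t - s by rewrite ge_min lexx orbT.
have tE : t - h - t = - h by ring.
have := Hd (t - h); rewrite tE normrN gtr0_norm//.
have -> : h < d by lra.
move=> /(_ isT); rewrite ler_norml => /andP[+ _].
have : f (t - h) <= f t by apply: fm; apply/andP; split; lra.
have lh : l * h < 0 by rewrite nmulr_rlt0.
by move=> ? ?; lra.
Qed.

(* The derivative of [f] is only required to be differentiable at the maximum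
   point, so the second-order condition is read off the mean value theorem. *)
Lemma second_derive_max_le0 (R : realType) (f g : R -> R) (a b x l : R) :
  a < x < b -> (forall y, a < y < b -> is_derive y 1 f (g y)) ->
  is_derive x 1 g l -> (forall y, a < y < b -> f y <= f x) ->
  g x = 0 /\ l <= 0.
Proof.
move=> /[dup] axb /andP[ax xb] df dg fm.
have gx0 : g x = 0.
  have h1 : 0 <= g x.
    apply: (@derive_left_max_ge0 _ f ((a + x) / 2) x) => //; first lra.
      exact: df.
    by move=> r /andP[? ?]; apply: fm; apply/andP; split; lra.
  (* Points to the right of [x] are handled by the same criterion applied to the reflected
     function. *)
  have h2 : 0 <= - g x.
    apply: (@derive_left_max_ge0 _ (f \o -%R) (- ((b + x) / 2)) (- x)); first lra.
      have dfx : is_derive (- (- x)) 1 f (g x) by rewrite opprK; exact: df.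
      have -> : - g x = g x * (-1) by rewrite mulrN1.
      exact: is_derive1_comp.
    by move=> r /andP[? ?] /=; rewrite opprK; apply: fm; apply/andP; split; lra.
  by apply/eqP; rewrite eq_le; apply/andP; split; lra.
split => //; rewrite leNgt; apply/negP => l0.
have e0 : 0 < l / 2 by lra.
have /is_derive1P/(_ _ e0)[d d0 Hd] := dg.
pose h := Num.min (d / 2) ((b - x) / 2).
have h0 : 0 < h by rewrite lt_min; apply/andP; split; lra.
have h1 : h <= d / 2 by rewrite ge_min lexx.
have h2 : h <= (b - x) / 2 by rewrite ge_min lexx orbT.
have xh : x < x + h by rewrite ltrDl.
(* If [l > 0], then [g] is positive just to the right of [x], whereas maximality gives some [c]
   there with [g c <= 0]. *)
have [||c] := @MVT _ f g x (x + h) xh.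
- by move=> y; rewrite in_itv /= => /andP[? ?]; apply: df; apply/andP; split; lra.
- apply: derivable_within_continuous => y; rewrite in_itv /= => /andP[? ?].
  by have [] : is_derive y 1 f (g y) by apply: df; apply/andP; split; lra.
rewrite in_itv /= => /andP[xc ch].
have := fm (x + h); have -> : a < x + h < b by apply/andP; split; lra.
move=> /(_ isT) fmh.
have hE : x + h - x = h by ring.
rewrite hE => E; have : g c <= 0.
  by rewrite -(pmulr_lle0 _ h0) -E subr_le0.
have := Hd c; rewrite gtr0_norm; last by rewrite subr_gt0.
have -> : c - x < d by lra.
move=> /(_ isT); rewrite gx0 subr0 ler_norml => /andP[+ _].
have : 0 < l * (c - x) by rewrite mulr_gt0// subr_gt0.
by move=> ? ? ?; lra.
Qed.

(** * Continuity relative to a subset *)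

(** Serves both for restriction to a time slice and for the doubled variables, where [U] is
    evaluated at [(t, x)] and at [(t, y)]. *)
Lemma within_continuous_pair (R : realType) (T : topologicalType)
    (K : set T) (D : set (R * R)) (U : R -> R -> R) (f g : T -> R) :
  continuous_on2 D U -> continuous f -> continuous g ->
  (forall q, K q -> D (f q, g q)) ->
  {within K, continuous (fun q => U (f q) (g q))}.
Proof.
move=> /subspace_continuousP cU cf cg KD; apply/subspace_continuousP => q Kq.
have H : (f q', g q') @[q' --> within K (nbhs q)] -->
    within D (nbhs (f q, g q)).
  move=> P /= nP.
  have : (f q', g q') @[q' --> q] --> (f q, g q).
    apply: (@cvg_pair _ _ _ (nbhs q) (nbhs (f q)) (nbhs (g q))); [exact: cf|exact: cg].
  move=> /(_ _ nP) h.
  change (nbhs q (fun q' => D (f q', g q') -> P (f q', g q'))) in h.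
  change (nbhs q (fun q' => K q' -> P (f q', g q'))).
  by apply: filterS h => q' Pq' Kq'; apply: Pq'; exact: KD.
exact: (cvg_comp _ _ H (cU _ (KD _ Kq))).
Qed.

Lemma within_continuous_postcomp (R : realType) (T : topologicalType)
    (K : set T) (G : R -> R) (f : T -> R) :
  {within K, continuous f} -> (forall q, K q -> {for f q, continuous G}) ->
  {within K, continuous (fun q => G (f q))}.
Proof.
move=> /subspace_continuousP cf cG; apply/subspace_continuousP => q Kq.
exact: (cvg_comp _ _ (cf q Kq) (cG q Kq)).
Qed.

Lemma within_continuousD (R : realType) (T : topologicalType) (K : set T)
    (f g : T -> R) : {within K, continuous f} -> {within K, continuous g} ->
  {within K, continuous (fun x => f x + g x)}.
Proof. by move=> cf cg x; apply: continuousD; [exact: cf|exact: cg]. Qed.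

Lemma within_continuousB (R : realType) (T : topologicalType) (K : set T)
    (f g : T -> R) : {within K, continuous f} -> {within K, continuous g} ->
  {within K, continuous (fun x => f x - g x)}.
Proof. by move=> cf cg x; apply: continuousB; [exact: cf|exact: cg]. Qed.

Lemma within_continuousM (R : realType) (T : topologicalType) (K : set T)
    (f g : T -> R) : {within K, continuous f} -> {within K, continuous g} ->
  {within K, continuous (fun x => f x * g x)}.
Proof. by move=> cf cg x; apply: continuousM; [exact: cf|exact: cg]. Qed.

Lemma within_continuous_cst (R : realType) (T : topologicalType) (K : set T)
    (c : R) : {within K, continuous (fun=> c)}.
Proof. by apply: continuous_subspaceT => x; exact: cst_continuous. Qed.

Lemma is_derive1_continuous (R : realType) (f : R -> R) (x l : R) :
  is_derive x 1 f l -> {for x, continuous f}.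
Proof. by case=> df _; exact/differentiable_continuous/derivable1_diffP. Qed.

(** * Comparison by doubling of variables *)

(** A product of segments cut by the closed condition [y <= x]; compactness provides the maximum
    point in the doubling argument. *)
Lemma compact_triangle (R : realType) (t0 t1 : R) :
  compact [set q : R * R * R |
    [/\ t0 <= q.1.1 <= t1, 0 <= q.1.2 <= 1 & 0 <= q.2 <= q.1.2]].
Proof.
rewrite (_ : mkset _ = (`[t0, t1] `*` `[0, 1]) `*` `[0, 1] `&`
    (fun q : R * R * R => q.1.2 - q.2) @^-1` [set x | 0 <= x]).
  apply: compact_closedI.
    by apply: compact_setX; [apply: compact_setX|]; exact: segment_compact.
  apply: preimage_closed; last exact: closed_ge.
  move=> q _; apply: (@continuousB _ R _ (fun q => q.1.2) snd q).
    by apply: continuous_comp; [exact: cvg_fst|exact: cvg_snd].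
  exact: cvg_snd.
apply/seteqP; split => -[[t x] y] /=; rewrite !in_itv /=.
  move=> [-> /andP[-> x1] /andP[-> yx]]; rewrite x1 (le_trans yx x1).
  by rewrite subr_ge0 yx.
by move=> [[[-> ->] /andP[-> _]]]; rewrite subr_ge0 => ->.
Qed.

Lemma is_derive01_ge0_nondecreasing (R : realType) (f df : R -> R) :
  (forall x, 0 <= x <= 1 -> is_derive01 f x (df x)) ->
  (forall x, 0 <= x <= 1 -> 0 <= df x) ->
  forall x y, 0 <= x <= y -> y <= 1 -> f x <= f y.
Proof.
move=> H Hd x y /andP[x0 xy] y1.
have [|||c] := @MVT_segment _ f df x y => //.
- move=> z; rewrite in_itv /= => /andP[xz zy].
  by apply: is_derive01_is_derive; [|apply: H]; apply/andP; split; lra.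
- apply: continuous_subspaceW (is_derive01_within_continuous H).
  by move=> z /=; rewrite !in_itv /= => /andP[? ?]; apply/andP; split; lra.
rewrite in_itv /= => /andP[xc cy] E.
rewrite -subr_ge0 E mulr_ge0 ?subr_ge0// Hd//; apply/andP; split; lra.
Qed.

(* Kruzhkov's doubling of variables: at an interior maximum point of
   [sg * (G (U t x - U t y) - (x - y))] the first-order conditions give
   [u t x = u t y = p D] with [D = U t x - U t y], and the second-order ones
   bound [sg * a * ux] at [x] from above and at [y] from below by [C * p D],
   which beats the drift term [u * (M x - U)] since [M < C]. *)
Lemma doubling_comparison (R : realType) (sg M C t0 t1 : R) (a p G : R -> R)
    (U u ux V : R -> R -> R) :
  (sg = 1 \/ sg = -1) -> t0 <= t1 -> M < C ->
  (forall r, 0 < r -> 0 < a r) ->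
  (forall z : R, 0 <= z <= M -> 0 < p z) ->
  (forall z : R, 0 <= z <= M -> is_derive z 1 G (p z)^-1) ->
  (forall z : R, 0 <= z <= M -> is_derive z 1 p (- sg * C / a (p z))) ->
  G 0 = 0 -> sg * (G M - 1) <= 0 ->
  continuous_on2 [set q | t0 <= q.1 <= t1 /\ 0 <= q.2 <= 1] U ->
  (forall t : R, t0 <= t <= t1 -> U t 0 = 0 /\ U t 1 = M) ->
  (forall t x : R, t0 <= t <= t1 -> 0 <= x <= 1 ->
    0 < u t x /\ is_derive01 (U t) x (u t x)) ->
  (forall t x : R, t0 <= t <= t1 -> 0 < x < 1 -> is_derive x 1 (u t) (ux t x)) ->
  (forall t x : R, t0 <= t <= t1 -> 0 <= x <= 1 -> is_derive t 1 (U^~ x) (V t x)) ->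
  (forall t : R, t0 <= t <= t1 -> V t 0 = 0 /\ V t 1 = 0) ->
  (forall t x : R, t0 <= t <= t1 -> 0 < x < 1 ->
    V t x = a (u t x) * ux t x - u t x * (M * x - U t x)) ->
  (forall x y : R, 0 <= y <= x -> x <= 1 ->
    sg * (G (U t0 x - U t0 y) - (x - y)) <= 0) ->
  forall t x y : R, t0 <= t <= t1 -> 0 <= y <= x -> x <= 1 ->
    sg * (G (U t x - U t y) - (x - y)) <= 0.
Proof.
move=> sg1 t01 MC a_gt0 p_gt0 dG dp G0 GM cU Ubd dU du dtU Vbd VE init.
have mono t x y : t0 <= t <= t1 -> 0 <= y <= x -> x <= 1 -> U t y <= U t x.
  move=> tT; apply: (@is_derive01_ge0_nondecreasing _ (U t) (u t)) => z z01.
    by case: (dU t z tT z01).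
  by case: (dU t z tT z01) => /ltW.
have U0M t x : t0 <= t <= t1 -> 0 <= x <= 1 -> 0 <= U t x <= M.
  move=> tT /andP[x0 x1]; have [U0 U1] := Ubd t tT.
  rewrite -{1}U0 -U1 !mono ?lexx ?x0 ?x1//.
(* Increments of [U t] stay in [0, M], the range on which [p] and [G] are controlled. *)
have DM t x y : t0 <= t <= t1 -> 0 <= y <= x -> x <= 1 ->
    0 <= U t x - U t y <= M.
  move=> tT yx x1; rewrite subr_ge0 mono//=.
  move: yx => /andP[y0 yx].
  have /andP[_ h1] : 0 <= U t x <= M by apply: U0M => //; apply/andP; split; lra.
  have /andP[h2 _] : 0 <= U t y <= M by apply: U0M => //; apply/andP; split; lra.
  lra.
pose K := [set q : R * R * R |
    [/\ t0 <= q.1.1 <= t1, 0 <= q.1.2 <= 1 & 0 <= q.2 <= q.1.2]].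
pose w (q : R * R * R) :=
  sg * (G (U q.1.1 q.1.2 - U q.1.1 q.2) - (q.1.2 - q.2)).
have Kn0 : K !=set0 by exists (t0, 0, 0); split => /=; rewrite lexx ?t01 ?ler01.
have c1 : continuous (fun q : R * R * R => q.1.1).
  by move=> q; apply: continuous_comp; [exact: cvg_fst|exact: cvg_fst].
have c2 : continuous (fun q : R * R * R => q.1.2).
  by move=> q; apply: continuous_comp; [exact: cvg_fst|exact: cvg_snd].
have c3 : continuous (fun q : R * R * R => q.2) by move=> q; exact: cvg_snd.
have cw : {within K, continuous w}.
  have cD : {within K, continuous (fun q => U q.1.1 q.1.2 - U q.1.1 q.2)}.
    apply: within_continuousB.
      by apply: (within_continuous_pair cU) => // -[[t x] y] [].
    apply: (within_continuous_pair cU) => // -[[t x] y] [/= h1 h2 h3].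
    by split=> //=; apply/andP; split; lra.
  have cG : {within K, continuous (fun q => G (U q.1.1 q.1.2 - U q.1.1 q.2))}.
    apply: (within_continuous_postcomp cD) => -[[t x] y] [/= h1 h2 h3].
    apply: is_derive1_continuous (dG _ _); apply: DM => //; lra.
  apply: within_continuousM; first exact: within_continuous_cst.
  apply: within_continuousB cG _.
  by apply: within_continuousB; exact: continuous_subspaceT.
have [[[t x] y]] := compact_EVT_max Kn0 (@compact_triangle _ t0 t1) cw.
rewrite inE => -[/= tT x01 /andP[y0 yx]] wmax.
suff w0 : w (t, x, y) <= 0.
  move=> t' x' y' tT' yx' x1'; apply: le_trans w0.
  apply: (wmax (t', x', y')); rewrite inE; split => //=.
  by move: yx' => /andP[? ?]; apply/andP; split; lra.
(* A positive maximum lies neither at time [t0], by [init], nor on the diagonal, where [w] vanishes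
   because [G 0 = 0]. The sides [x = 1] and [y = 0] remain possible. *)
rewrite leNgt; apply/negP => w_gt0.
have {}wmax t' x' y' : t0 <= t' <= t1 -> 0 <= y' <= x' -> x' <= 1 ->
    w (t', x', y') <= w (t, x, y).
  move=> h1 h2 h3; apply: wmax; rewrite inE; split => //=.
  by move: h2 => /andP[? ?]; apply/andP; split; lra.
move: x01 (tT) => /andP[x0 x1] /andP[t0t tt1].
have x01 : 0 <= x <= 1 by rewrite x0.
have y01 : 0 <= y <= 1 by apply/andP; split; lra.
have yxx : 0 <= y <= x by rewrite y0.
have t0t' : t0 < t.
  rewrite lt_neqAle t0t andbT; apply/eqP => tE.
  by move: w_gt0; rewrite /w /= -tE ltNge init.
have yx' : y < x.
  rewrite lt_neqAle yx andbT; apply/eqP => yE.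
  by move: w_gt0; rewrite /w /= yE !subrr G0 subrr mulr0 ltxx.
set D := U t x - U t y.
have D0M : 0 <= D <= M by exact: DM.
have pD := p_gt0 D D0M; have aD := a_gt0 _ pD.
have sg2 : sg * sg = 1 by case: sg1 => ->; ring.
have driftM z : 0 <= z <= 1 -> - M <= M * z - U t z <= M.
  move=> /[dup] z01 /andP[z0 z1]; have /andP[h1 h2] := U0M t z tT z01.
  by apply/andP; split; nra.
have dGx z : 0 <= z -> y <= z -> z <= 1 ->
    is_derive (U t z - U t y) 1 G (p (U t z - U t y))^-1.
  by move=> z0 yz z1; apply: dG; apply: DM => //; rewrite y0.
have dGy z : 0 <= z -> z <= x -> is_derive (U t x - U t z) 1 G (p (U t x - U t z))^-1.
  by move=> z0 yz; apply: dG; apply: DM => //; rewrite z0.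
(* At an interior [x] the maximum conditions give a strict sign; at [x = 1] the value [V] is
   zero. *)
have Vx : sg * V t x <= 0 /\ (x < 1 -> sg * V t x < 0).
  suff H : x < 1 -> sg * V t x < 0.
    split=> //; have [/H/ltW//|x1'] := ltP x 1.
    have -> : x = 1 by apply/eqP; rewrite eq_le x1.
    by have [_ ->] := Vbd t tT; rewrite mulr0.
  move=> xlt; have x01' : 0 < x < 1 by rewrite xlt (le_lt_trans y0 yx').
  pose f z := sg * (G (U t z - U t y) - (z - y)).
  pose g z := sg * ((p (U t z - U t y))^-1 * u t z - 1).
  have duz z : y < z < 1 -> is_derive z 1 (fun z => U t z - U t y) (u t z).
    move=> /andP[yz z1]; have z0 := le_lt_trans y0 yz.
    have duz : is_derive z 1 (U t) (u t z).
      apply: is_derive01_is_derive; first by rewrite z0.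
      by case: (dU t z tT); first by rewrite !ltW.
    by apply: is_derive_eq; rewrite subr0.
  have df z : y < z < 1 -> is_derive z 1 f (g z).
    move=> /[dup] yz1 /andP[yz z1].
    have dGz := dGx z (ltW (le_lt_trans y0 yz)) (ltW yz) (ltW z1).
    have H1 := @is_derive1_comp _ G _ z _ _ dGz (duz z yz1).
    have H2 : is_derive z 1 (fun z => z - y) 1.
      by apply: is_derive_eq; rewrite subr0.
    apply: (@is_derive_eq _ _ _ _ _ _ _ _ (is_deriveZ sg (is_deriveB H1 H2))).
    by [].
  have dgx : is_derive x 1 g
      (sg * (- (p D) ^- 2 * (- sg * C / a (p D) * u t x) * u t x + (p D)^-1 * ux t x)).
    have xin : y < x < 1 by rewrite yx'.
    have H1 := @is_derive1_comp _ p (fun z => U t z - U t y) x _ _ (dp D D0M) (duz x xin).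
    have pn0 : (p \o (fun z => U t z - U t y)) x != 0 by rewrite gt_eqF.
    have H2 := is_deriveM (is_deriveV pn0 H1) (du t x tT x01').
    have H3 := is_deriveZ sg (is_deriveB H2 (is_derive_cst (1 : R) x 1)).
    apply: (@is_derive_eq _ _ _ _ _ _ _ _ H3).
    rewrite subr0 /GRing.scale /= -/D; ring.
  have [||g0 l0] := @second_derive_max_le0 _ f g y 1 x _ _ df dgx.
  - by rewrite yx'.
  - move=> z /andP[yz z1].
    by apply: (wmax t z y tT); [rewrite y0 ltW|exact: ltW].
  have up : u t x = p D.
    have /eqP : sg * g x = 0 by rewrite g0 mulr0.
    rewrite /g mulrA sg2 mul1r -/D subr_eq0 => /eqP/(congr1 ( *%R (p D))).
    by rewrite mulr1 mulrA divff ?gt_eqF// mul1r.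
  (* Multiplying the second-order condition by [p D * a (p D) > 0] and using [u t x = p D] cancels
     every denominator, including that of [p']. *)
  have {}l0 : sg * a (p D) * ux t x <= - C * p D.
    have E : (p D * a (p D)) * (sg * (- (p D) ^- 2 *
        (- sg * C / a (p D) * u t x) * u t x + (p D)^-1 * ux t x)) =
        (sg * sg) * C * p D + sg * a (p D) * ux t x.
      by rewrite up; field; rewrite !gt_eqF.
    move: l0; rewrite -(pmulr_rle0 _ (mulr_gt0 pD aD)) E sg2 => h.
    by clear - h; lra.
  have /andP[d1 d2] := driftM x x01.
  rewrite (VE t x tT x01') up; set dr := M * x - U t x in d1 d2 *.
  have hd : - (sg * dr) <= M by clear - sg1 d1 d2; case: sg1 => ->; lra.
  by clear - pD MC l0 hd; nra.
(* The same argument in [y], with opposite signs since [U t y] and [y] are subtracted. *)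
have Vy : 0 <= sg * V t y /\ (0 < y -> 0 < sg * V t y).
  suff H : 0 < y -> 0 < sg * V t y.
    split=> //; have [/H/ltW//|y0'] := ltP 0 y.
    have -> : y = 0 by apply/eqP; rewrite eq_le y0 y0'.
    by have [-> _] := Vbd t tT; rewrite mulr0.
  move=> ygt; have y01' : 0 < y < 1 by rewrite ygt (lt_le_trans yx' x1).
  pose f z := sg * (G (U t x - U t z) - (x - z)).
  pose g z := sg * (1 - (p (U t x - U t z))^-1 * u t z).
  have duz z : 0 < z < x -> is_derive z 1 (fun z => U t x - U t z) (- u t z).
    move=> /andP[z0 zx]; have z1 := lt_le_trans zx x1.
    have duz : is_derive z 1 (U t) (u t z).
      apply: is_derive01_is_derive; first by rewrite z0.
      by case: (dU t z tT); first by rewrite !ltW.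
    exact: is_derive_eq (is_deriveB (is_derive_cst (U t x) z 1) duz) (sub0r _).
  have df z : 0 < z < x -> is_derive z 1 f (g z).
    move=> /[dup] yz1 /andP[yz z1].
    have H1 := @is_derive1_comp _ G _ z _ _ (dGy z (ltW yz) (ltW z1)) (duz z yz1).
    have H2 : is_derive z 1 (fun z => x - z) (-1).
      exact: is_derive_eq (is_deriveB (is_derive_cst x z 1) (is_derive_id z 1))
        (sub0r _).
    apply: (@is_derive_eq _ _ _ _ _ _ _ _ (is_deriveZ sg (is_deriveB H1 H2))).
    by rewrite /g /GRing.scale /=; ring.
  have dgx : is_derive y 1 g
      (sg * (- (- (p D) ^- 2 * (- sg * C / a (p D) * - u t y) * u t y +
        (p D)^-1 * ux t y))).
    have yin : 0 < y < x by rewrite ygt.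
    have H1 := @is_derive1_comp _ p (fun z => U t x - U t z) y _ _ (dp D D0M) (duz y yin).
    have pn0 : (p \o (fun z => U t x - U t z)) y != 0 by rewrite gt_eqF.
    have H2 := is_deriveM (is_deriveV pn0 H1) (du t y tT y01').
    have H3 := is_deriveZ sg (is_deriveB (is_derive_cst (1 : R) y 1) H2).
    apply: (@is_derive_eq _ _ _ _ _ _ _ _ H3).
    rewrite sub0r /GRing.scale /= -/D; ring.
  have [||g0 l0] := @second_derive_max_le0 _ f g 0 x y _ _ df dgx.
  - by rewrite yx' ygt.
  - move=> z /andP[z0 zx].
    by apply: (wmax t x z tT _ x1); rewrite !ltW.
  have up : u t y = p D.
    have /eqP : sg * g y = 0 by rewrite g0 mulr0.
    rewrite /g mulrA sg2 mul1r -/D subr_eq0 eq_sym => /eqP/(congr1 ( *%R (p D))).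
    by rewrite mulr1 mulrA divff ?gt_eqF// mul1r.
  have {}l0 : C * p D <= sg * a (p D) * ux t y.
    have E : (p D * a (p D)) * (sg * (- (- (p D) ^- 2 *
        (- sg * C / a (p D) * - u t y) * u t y + (p D)^-1 * ux t y))) =
        (sg * sg) * C * p D - sg * a (p D) * ux t y.
      by rewrite up; field; rewrite !gt_eqF.
    move: l0; rewrite -(pmulr_rle0 _ (mulr_gt0 pD aD)) E sg2 => h.
    by clear - h; lra.
  have /andP[d1 d2] := driftM y y01.
  rewrite (VE t y tT y01') up; set dr := M * y - U t y in d1 d2 *.
  have hd : sg * dr <= M by clear - sg1 d1 d2; case: sg1 => ->; lra.
  by clear - pD MC l0 hd; nra.
(* Both signs are weak only when [x = 1] and [y = 0]; there the increment is [M] and the hypothesis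
   on [G M - 1] contradicts positivity. *)
have V_lt0 : sg * (V t x - V t y) < 0.
  case: Vx Vy => [V1 V2] [V3 V4]; rewrite mulrBr subr_lt0.
  have [/V2 h|x1'] := ltP x 1; first exact: lt_le_trans h V3.
  have [/V4 h|y0'] := ltP 0 y; first exact: le_lt_trans V1 h.
  have xE : x = 1 by apply/eqP; rewrite eq_le x1.
  have yE : y = 0 by apply/eqP; rewrite eq_le y0 y0'.
  move: w_gt0; rewrite /w /= xE yE; have [-> ->] := Ubd t tT.
  by rewrite !subr0 ltNge GM.
have dtD : is_derive t 1 (fun s => sg * (G (U s x - U s y) - (x - y)))
    (sg * ((p D)^-1 * (V t x - V t y))).
  have H1 := is_deriveB (dtU t x tT x01) (dtU t y tT y01).
  have H2 := @is_derive1_comp _ G (fun s => U s x - U s y) t _ _ (dG D D0M) H1.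
  have H3 := is_deriveZ sg (is_deriveB H2 (is_derive_cst (x - y) t 1)).
  by apply: (@is_derive_eq _ _ _ _ _ _ _ _ H3); rewrite subr0.
(* Maximality over earlier times forces a nonnegative time derivative, against [V_lt0]. *)
have : 0 <= sg * ((p D)^-1 * (V t x - V t y)).
  apply: (derive_left_max_ge0 t0t' dtD) => s /andP[s0 st].
  by apply: (wmax s x y _ yxx x1); rewrite s0 (le_trans st tt1).
rewrite leNgt mulrCA pmulr_rlt0 ?invr_gt0// V_lt0//.
Qed.

(** * Time derivatives of space primitives *)

Lemma continuous_on2_dist (R : realType) (D : set (R * R)) (w : R -> R -> R)
    (t x e : R) : continuous_on2 D w -> D (t, x) -> 0 < e ->
  exists2 d, 0 < d & forall s y, D (s, y) -> `|s - t| < d -> `|y - x| < d ->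
    `|w s y - w t x| < e.
Proof.
move=> /subspace_continuousP cw Dtx e0.
have /cvgrPdist_lt/(_ e e0) := cw _ Dtx.
rewrite /within /= => /nbhs_ballP[d /= d0 Hd]; exists d => // s y Dsy sd yd.
rewrite distrC; apply: (Hd (s, y)) => //.
by split; rewrite /= /ball /= distrC.
Qed.

Lemma continuous_on2_slice (R : realType) (D : set (R * R)) (w : R -> R -> R)
    (t : R) : continuous_on2 D w -> (forall x, 0 <= x <= 1 -> D (t, x)) ->
  {within `[0, 1], continuous (w t)}.
Proof.
move=> cw H; apply: (within_continuous_pair cw (f := cst t) (g := id)).
- exact: cst_continuous.
- by move=> x.
- by move=> x; rewrite /= in_itv /=; exact: H.
Qed.

(** Compactness of [0, 1] makes the time radius independent of [y]; near each [x], both values are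
    compared with [w t x]. *)
Lemma uniform_in_space (R : realType) (D : set (R * R)) (w : R -> R -> R)
    (t e : R) : continuous_on2 D w -> (forall x, 0 <= x <= 1 -> D (t, x)) ->
  0 < e -> exists2 d, 0 < d & forall s, `|s - t| < d ->
    forall y, 0 <= y <= 1 -> D (s, y) -> `|w s y - w t y| <= e.
Proof.
move=> cw Dt e0; pose P (s y : R) := D (s, y) -> `|w s y - w t y| <= e.
have /compact_near_coveringP/near_covering_withinP cov :=
  @segment_compact R 0 1.
have : \forall s \near t, `[0, 1] `<=` P s.
  apply: (cov R (nbhs t) P _) => x; rewrite /= in_itv /= => x01.
  have e2 : 0 < e / 2 by rewrite divr_gt0.
  have [d d0 Hd] := continuous_on2_dist cw (Dt x x01) e2.
  exists (ball x d, ball t d) => /=; first by split; exact: nbhsx_ballx.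
  move=> [y s] [/=]; rewrite /ball /= distrC => yd; rewrite distrC => sd.
  rewrite in_itv /= => y01 Dsy.
  have h1 := Hd s y Dsy sd yd.
  have h2 : `|w t y - w t x| < e / 2.
    by apply: Hd => //; [exact: Dt|rewrite subrr normr0].
  rewrite (_ : w s y - w t y = (w s y - w t x) - (w t y - w t x)); last by ring.
  by apply: le_trans (ler_normB _ _) _; rewrite [leRHS]splitr lerD// ltW.
move=> /nbhs_ballP[d /= d0 Hd]; exists d => // s sd y y01.
by apply: (Hd s) => /=; [rewrite /ball /= distrC|rewrite in_itv].
Qed.

(** The bounds with min and max leave the order of [x] and [y] free, as needed for time increments
    of either sign. *)
Lemma MVT_norm_le (R : realType) (f g : R -> R) (x y e : R) :
  (forall z, Num.min x y <= z <= Num.max x y -> is_derive z 1 f (g z)) ->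
  (forall z, Num.min x y <= z <= Num.max x y -> `|g z| <= e) ->
  `|f y - f x| <= e * `|y - x|.
Proof.
wlog xy : x y / x <= y.
  have [xy|/ltW yx] := leP x y; first by move=> /(_ x y xy); rewrite min_l // max_r.
  by move=> /(_ y x yx); rewrite minC maxC min_r // max_l // distrC (distrC y).
rewrite min_l // max_r // => df ge.
have [||c] := @MVT_segment _ f g x y xy.
- by move=> z; rewrite in_itv /= => /andP[? ?]; apply: df; apply/andP; split; lra.
- apply: derivable_within_continuous => z; rewrite in_itv /= => z1.
  by case: (df z z1).
by rewrite in_itv /= => c1 ->; rewrite normrM ler_wpM2r// ge.
Qed.

(* Differentiation under the integral sign without integrals: [U s] is the
   primitive of [u s] vanishing at [0], and the mean value theorem is applied in
   space to [U s - U t - (s - t) Q] and in time to [u]. *)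
Lemma is_derive_time_primitive (R : realType) (t0 t1 t : R)
    (U u ut : R -> R -> R) (Q : R -> R) : t0 < t < t1 ->
  (forall s x : R, t0 < s < t1 -> 0 <= x <= 1 -> is_derive01 (U s) x (u s x)) ->
  (forall s x : R, t0 < s < t1 -> 0 <= x <= 1 ->
    is_derive s 1 (u^~ x) (ut s x)) ->
  continuous_on2 [set q | t0 < q.1 < t1 /\ 0 <= q.2 <= 1] ut ->
  (forall x : R, 0 < x < 1 -> is_derive x 1 Q (ut t x)) ->
  {within `[0, 1], continuous Q} ->
  Q 0 = 0 -> (forall s, t0 < s < t1 -> U s 0 = 0) ->
  forall x : R, 0 <= x <= 1 -> is_derive t 1 (U^~ x) (Q x).
Proof.
move=> tT dU du cut dQ cQ Q0 U0 x /andP[x0 x1].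
apply/is_derive1P => e e0.
have [|d d0 Hd] := @uniform_in_space _ _ _ t e cut _ e0; first by [].
move: (tT) => /andP[tt0 tt1].
exists (Num.min d (Num.min (t - t0) (t1 - t))).
  by rewrite !lt_min d0 !subr_gt0 tt0.
move=> s; rewrite !lt_min => /and3P[sd st0 st1].
have sT : t0 < s < t1.
  by move: st0 st1; rewrite !ltr_norml => /andP[? ?] /andP[? ?]; apply/andP; split; lra.
have [->|xgt] : x = 0 \/ 0 < x by case: (ltgtP 0 x) x0 => // [|<-]; [right|left].
  by rewrite !U0// Q0 mul0r !subrr normr0 mulr_ge0// ltW.
pose F y := U s y - U t y - (s - t) * Q y.
pose F' y := u s y - u t y - (s - t) * ut t y.
have cF : {within `[0, x], continuous F}.
  have sub : `[0, x] `<=` `[0, 1].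
    by move=> y; rewrite /= !in_itv /= => /andP[-> yx]; apply: le_trans x1.
  apply: continuous_subspaceW sub _; apply: within_continuousB.
    by apply: within_continuousB; apply: is_derive01_within_continuous => y;
      exact: dU.
  by apply: within_continuousM => //; exact: within_continuous_cst.
have dF y : y \in `]0, x[ -> is_derive y 1 F (F' y).
  rewrite in_itv /= => /andP[y0 yx].
  have y01 : 0 < y < 1 by apply/andP; split; lra.
  have y01' : 0 <= y <= 1 by apply/andP; split; lra.
  have H1 := is_derive01_is_derive y01 (dU s y sT y01').
  have H2 := is_derive01_is_derive y01 (dU t y tT y01').
  exact: (is_deriveB (is_deriveB H1 H2) (is_deriveZ (s - t) (dQ y y01))).
have [c] := MVT xgt dF cF; rewrite in_itv /= => /andP[c0 cx] E.
have c01 : 0 <= c <= 1 by apply/andP; split; lra.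
have F0 : F 0 = 0 by rewrite /F !U0// Q0 mulr0 !subrr.
move: E; rewrite F0 !subr0 => E.
rewrite (_ : U s x - U t x - Q x * (s - t) = F x); last by rewrite /F; ring.
rewrite E normrM (gtr0_norm xgt).
suff : `|F' c| <= e * `|s - t|.
  move=> h; apply: le_trans (ler_wpM2r (ltW xgt) h) _.
  by rewrite ler_piMr// mulr_ge0// ltW.
have itv r : Num.min t s <= r <= Num.max t s -> t0 < r < t1 /\ `|r - t| < d.
  case/andP: sT => s0 s1 /andP[r0 r1]; split.
    apply/andP; split; [apply: lt_le_trans r0|apply: le_lt_trans r1 _].
      by rewrite lt_min tt0 s0.
    by rewrite gt_max tt1 s1.
  move: sd; rewrite !ltr_norml => /andP[? ?].
  by move: r0 r1; rewrite /Num.min /Num.max; case: ifP => _ ? ?; apply/andP; split; lra.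
(* Subtracting the linear term leaves the derivative [ut r c - ut t c], which is at most [e] in
   absolute value by the choice of [d]. *)
have := @MVT_norm_le _ (fun r => u r c - r * ut t c) (fun r => ut r c - ut t c) t s e.
rewrite (_ : _ - _ - _ = F' c); last by rewrite /F'; ring.
apply.
  move=> r /itv[rT _].
  have H1 := is_deriveB (du r c rT c01)
    (is_deriveM (is_derive_id r 1) (is_derive_cst (ut t c) r 1)).
  apply: (@is_derive_eq _ _ _ _ _ _ _ _ H1).
  by rewrite scaler0 add0r /GRing.scale /= mulr1.
by move=> r /itv[rT rd]; apply: Hd.
Qed.

(** * Primitives of [a] and the barrier *)

Lemma primitive_increasing (R : realType) (a A : R -> R) :
  (forall r : R, 0 < r -> 0 < a r) ->
  (forall r : R, 0 < r -> is_derive r 1 A (a r)) ->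
  forall x y : R, 0 < x -> x < y -> A x < A y.
Proof.
move=> a0 dA x y x0 xy.
have [||c] := @MVT _ A a x y xy.
- by move=> z; rewrite in_itv /= => /andP[xz _]; apply: dA; lra.
- apply: derivable_within_continuous => z; rewrite in_itv /= => /andP[xz _].
  by have [] : is_derive z 1 A (a z) by apply: dA; lra.
rewrite in_itv /= => /andP[xc _] E.
by rewrite -subr_gt0 E mulr_gt0 ?subr_gt0// a0//; lra.
Qed.

Lemma continuous_primitive (R : realType) (f : R -> R) (c d : R) :
  (forall x, c <= x <= d -> {for x, continuous f}) ->
  exists F : R -> R, forall x, c < x < d -> is_derive x 1 F (f x).
Proof.
move=> cf; exists (fun x => (\int[lebesgue_measure]_(t in [set` `[c, x]]) f t)%R).
move=> x /andP[cx xd].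
have fi : lebesgue_measure.-integrable `[c, d] (EFin \o f).
  apply: continuous_compact_integrable; first exact: segment_compact.
  apply: continuous_in_subspaceT => y; rewrite inE /= in_itv /=; exact: cf.
have [|dF F'] := @continuous_FTC1_closed R f c x d xd fi cx.
  by apply: cf; apply/andP; split; lra.
by split; [exact: dF|rewrite -derive1E; exact: F'].
Qed.

(* [p] solves [a(p) p' = - sg C]; unboundedness of [A] on the relevant side is
   what lets [p] run over a range of length [M] without crossing [K]. *)
Lemma exists_barrier (R : realType) (sg K M C : R) (a A : R -> R) :
  (sg = 1 \/ sg = -1) -> 0 < K -> 0 < M -> 0 < C ->
  (forall r : R, 0 < r -> 0 < a r) ->
  (forall r : R, 0 < r -> is_derive r 1 A (a r)) ->
  (forall s, 0 <= sg * (s - A K) -> exists2 r, 0 < r & A r = s) ->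
  exists p G : R -> R, [/\ forall z : R, 0 <= z <= M -> 0 < p z,
    forall z : R, 0 <= z <= M -> is_derive z 1 G (p z)^-1,
    forall z : R, 0 <= z <= M -> is_derive z 1 p (- sg * C / a (p z)),
    G 0 = 0 &
    forall z : R, 0 <= z <= M -> sg * (G z - z / K) <= 0].
Proof.
move=> sg1 K0 M0 C0 a0 dA surj.
have sg2 : sg * sg = 1 by case: sg1 => ->; ring.
have incA := primitive_increasing a0 dA.
have injA x y : 0 < x -> 0 < y -> A x = A y -> x = y.
  move=> x0 y0 E; case: (ltgtP x y) => // h.
    by have := incA _ _ x0 h; rewrite E ltxx.
  by have := incA _ _ y0 h; rewrite E ltxx.
(* Inverse of [A] on the positive half-line; the default [0] is excluded wherever a positive
   preimage exists. *)
pose B s := xget 0 [set r | 0 < r /\ A r = s].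
have BE s : 0 <= sg * (s - A K) -> 0 < B s /\ A (B s) = s.
  move=> /surj[r r0 rE]; rewrite /B; case: xgetP => [y -> []//|].
  by move=> /(_ r) /=; tauto.
have BA r : 0 < r -> B (A r) = r.
  move=> r0; rewrite /B; case: xgetP => [y -> [y0 yE]|/(_ r) /=]; last tauto.
  exact: injA.
have dB r : 0 < r -> is_derive (A r) 1 B (a r)^-1.
  move=> r0; have r0' : \forall r' \near r, 0 < r' by exact: lt_nbhsr.
  apply: is_derive_inverse.
  - by near=> r'; apply: BA; near: r'.
  - near=> r'; apply: is_derive1_continuous (dA _ _); by near: r'.
  - exact: dA.
  - by rewrite gt_eqF// a0.
(* Since [A (p z) = s z] is affine with slope [- sg * C], [p] solves the required equation. Taking
   [M + 1] instead of [M] keeps [s] on the admissible side of [A K] beyond [z = M]. *)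
pose s (z : R) := A K + sg * C * (M + 1 - z).
pose p z := B (s z).
have sgs z : z <= M + 1 -> 0 <= sg * (s z - A K).
  move=> zM; rewrite /s addrAC subrr add0r !mulrA sg2 mul1r.
  by rewrite mulr_ge0 ?subr_ge0// ltW.
have p_gt0 z : z <= M + 1 -> 0 < p z by move=> /sgs/BE[].
have Ap z : z <= M + 1 -> A (p z) = s z by move=> /sgs/BE[].
have pK z : z <= M + 1 -> 0 <= sg * (p z - K).
  move=> zM; have := sgs z zM; rewrite -(Ap z zM); have pz := p_gt0 z zM.
  case: sg1 => ->; rewrite ?mul1r ?mulN1r ?oppr_ge0 ?subr_ge0 ?subr_le0.
    by move=> h; rewrite leNgt; apply/negP => /(incA _ _ pz); rewrite ltNge h.
  by move=> h; rewrite leNgt; apply/negP => /(incA _ _ K0); rewrite ltNge h.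
have dp (z : R) : z <= M + 1 -> is_derive z 1 p (- sg * C / a (p z)).
  move=> zM.
  have ds : is_derive z 1 s (- sg * C).
    have H1 := is_deriveD (is_derive_cst (A K) z 1) (is_deriveZ (sg * C)
      (is_deriveB (is_derive_cst (M + 1) z 1) (is_derive_id z 1))).
    apply: (@is_derive_eq _ _ _ _ _ _ _ _ H1).
    by rewrite /GRing.scale /=; ring.
  have := dB _ (p_gt0 z zM); rewrite (Ap z zM) => dBz.
  have H := @is_derive1_comp _ B s z _ _ dBz ds.
  by apply: (@is_derive_eq _ _ _ _ _ _ _ _ H); rewrite mulrC.
(* On this larger interval [0] and [M] are interior points, so [G] has two-sided derivatives
   there. *)
have [|F dF] := @continuous_primitive _ (fun z => (p z)^-1) (-1) (M + 1).
  move=> z /andP[_ zM]; apply: continuousV; first by rewrite gt_eqF// p_gt0.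
  exact: is_derive1_continuous (dp z zM).
pose G z := F z - F 0.
have dG (z : R) : -1 < z < M + 1 -> is_derive z 1 G (p z)^-1.
  move=> zI; have H := is_deriveB (dF z zI) (is_derive_cst (F 0) z 1).
  by apply: (@is_derive_eq _ _ _ _ _ _ _ _ H); rewrite subr0.
exists p, G; split.
- by move=> z /andP[z0 z1]; apply: p_gt0; lra.
- by move=> z /andP[z0 z1]; apply: dG; apply/andP; split; lra.
- by move=> z /andP[z0 z1]; apply: dp; lra.
- by rewrite /G subrr.
move=> z /andP[z0 z1].
(* Thus [G z = z / p c], and [pK] tells on which side of [1 / K] the number [1 / p c] lies. *)
have [||c] := @MVT_segment _ G (fun z => (p z)^-1) 0 z z0.
- by move=> y; rewrite in_itv /= => /andP[? ?]; apply: dG; apply/andP; split; lra.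
- apply: derivable_within_continuous => y; rewrite in_itv /= => /andP[? ?].
  by have [] : is_derive y 1 G (p y)^-1 by apply: dG; apply/andP; split; lra.
rewrite in_itv /= => /andP[c0 c1]; rewrite {2}/G subrr !subr0 => ->.
have cM : c <= M + 1 by lra.
have pc := p_gt0 c cM; have := pK c cM.
rewrite (_ : (p c)^-1 * z - z / K = - (p c - K) * (z / (p c * K))); last first.
  by field; rewrite !gt_eqF.
rewrite mulNr mulrN mulrA oppr_le0 => h; apply: mulr_ge0 => //.
by rewrite divr_ge0// mulr_ge0// ltW.
Unshelve. all: by end_near. Qed.

(** The increments are the integrals of [a] over [[l n, r n]]. If all were at most [b], monotone
    convergence would make [a] integrable on the union, hence on [D]. A general exhaustion covers
    the behaviour at infinity and at zero together. *)
Lemma nonintegrable_primitive_unbounded (R : realType) (a A : R -> R)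
    (D : set R) (l r : nat -> R) (b : R) :
  C1_pos a -> (forall x : R, 0 < x -> 0 < a x) ->
  (forall x : R, 0 < x -> is_derive x 1 A (a x)) ->
  measurable D ->
  (forall n, 0 < l n < r n) ->
  (forall n, l n.+1 <= l n) -> (forall n, r n <= r n.+1) ->
  (forall x, D x -> exists n, l n <= x <= r n) ->
  ~ L1_on D a -> exists n, b < A (r n) - A (l n).
Proof.
move=> aC1 a0 dA mD lr decl incr sub nL1; apply: contrapT => nex.
apply: nL1; pose F n := `[l n, r n]%classic : set R.
have Apos n : F n `<=` [set x | 0 < x].
  move=> x; rewrite /F /= in_itv /= => /andP[lx _].
  by case/andP: (lr n) => l0 _; exact: lt_le_trans lx.
have ca x : 0 < x -> {for x, continuous a}.
  by move=> /aC1[da _]; exact/differentiable_continuous/derivable1_diffP.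
have cFn n : {within F n, continuous a}.
  apply: continuous_in_subspaceT => x; rewrite inE => /Apos; exact: ca.
have mF n : measurable (F n) by exact: measurable_itv.
have mfa n : measurable_fun (F n) a.
  by apply: subspace_continuous_measurable_fun.
have U_m : measurable (\bigcup_n F n) by exact: bigcup_measurable.
have mU : measurable_fun (\bigcup_n F n) a.
  by apply/measurable_fun_bigcup.
apply: (@integrableS _ (measurableTypeR R) R lebesgue_measure
  (\bigcup_n F n) D (EFin \o a) U_m mD).
  by move=> x /sub[n xn]; exists n => //; rewrite /F /= in_itv.
apply/integrableP; split; first exact/measurable_EFinP.
under eq_integral => x xU.
  have -> : (`|(EFin \o a) x| = (EFin \o a) x)%E.
    rewrite /= ger0_norm//; move: xU; rewrite inE => -[n _ /Apos xn].
    by rewrite ltW// a0.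
  over.
have nnd : nondecreasing_seq F.
  apply/nondecreasing_seqP => n; apply/subsetPset => x.
  rewrite /F /= !in_itv /= => /andP[h1 h2].
  by rewrite (le_trans (decl n) h1) (le_trans h2 (incr n)).
have mfE n : measurable_fun (F n : set (measurableTypeR R))
    (EFin \o a : measurableTypeR R -> \bar R).
  by apply/measurable_EFinP; exact: mfa.
have := @ge0_nondecreasing_set_cvg_integral _ (measurableTypeR R) R F (EFin \o a)
  lebesgue_measure nnd mF mfE.
have f0 i x : F i x -> (0 <= (EFin \o a) x)%E.
  by move=> /Apos x0; rewrite /= lee_fin ltW// a0.
move=> /(_ f0) cvgI.
apply: (@le_lt_trans _ _ b%:E); last exact: ltry.
rewrite -(cvg_lim _ cvgI)//.
apply: lime_le; first by apply/cvg_ex; eexists; exact: cvgI.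
apply: nearW => n.
have /andP[l0 lrn] := lr n.
rewrite (@continuous_FTC2 _ a A (l n) (r n) lrn).
- rewrite -EFinB lee_fin leNgt; apply/negP => h; apply: nex; by exists n.
- exact: cFn.
- split.
  + by move=> x; rewrite in_itv /= => /andP[lx _]; case: (dA x (lt_trans l0 lx)).
  + apply: cvg_at_right_filter; exact: is_derive1_continuous (dA _ l0).
  + apply: cvg_at_left_filter; exact: is_derive1_continuous (dA _ (lt_trans l0 lrn)).
- move=> x; rewrite in_itv /= => /andP[lx _].
  by have [? <-] := dA x (lt_trans l0 lx); rewrite derive1E.
Qed.

(** * Cumulative mass and flux of a solution *)

Lemma le0_closure01 (R : realType) (g : R -> R) :
  {within `[0, 1], continuous g} -> (forall x, 0 < x < 1 -> g x <= 0) ->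
  forall x, 0 <= x <= 1 -> g x <= 0.
Proof.
move=> /subspace_continuousP cg g0 x x01; rewrite leNgt; apply/negP => gx.
have xin : `[0, 1]%classic x by rewrite /= in_itv.
have /cvgrPdist_lt/(_ _ gx) := cg x xin.
rewrite /within /= => /nbhs_ballP[d /= d0 Hd].
pose s := Num.min 1 d.
have s0 : 0 < s by rewrite lt_min ltr01.
have s1 : s <= 1 by rewrite ge_min lexx.
have sd : s <= d by rewrite ge_min lexx orbT.
(* Moving [x] towards the midpoint by the fraction [s] gives an interior point at distance at most
   [s / 2]. *)
pose y := x + (2^-1 - x) * s.
have y01 : 0 < y < 1.
  by rewrite /y; case/andP: x01 => ? ?; apply/andP; split; nra.
have xy : ball x d y.
  rewrite /ball /= /y opprD addNKr normrN normrM (gtr0_norm s0).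
  have : `|2^-1 - x| <= 2^-1.
    by rewrite ler_norml; case/andP: x01 => ? ?; apply/andP; split; lra.
  by have := normr_ge0 (2^-1 - x); nra.
have yin : `[0, 1]%classic y.
  by rewrite /= in_itv /=; case/andP: y01 => /ltW -> /ltW ->.
have : `|g x - g y| < g x := Hd y xy yin.
rewrite ltr_norml => /andP[_]; have := g0 y y01; move=> ? ?; lra.
Qed.

Lemma lt_ereal_between (R : realType) (t : R) (T : \bar R) : (t%:E < T)%E ->
  exists2 t1, t < t1 & (t1%:E < T)%E.
Proof.
case: T => [r||//]; last by exists (t + 1); rewrite ?ltrDl ?ltry.
by rewrite lte_fin => tr; exists ((t + r) / 2); rewrite ?lte_fin ?midf_lt.
Qed.

Section SolutionFacts.
Variables (R : realType) (a A u0 : R -> R) (M : R) (T : \bar R).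
Variables (u v : R -> R -> R).
Implicit Types t x y z s : R.
Hypothesis aC1 : C1_pos a.
Hypothesis a_gt0 : forall r : R, 0 < r -> 0 < a r.
Hypothesis dA : forall r : R, 0 < r -> is_derive r 1 A (a r).
Hypothesis M_gt0 : 0 < M.
Hypothesis sol : classical_solution a A u0 M T u v.
Hypothesis u_gt0 : forall t x, cyl T (t, x) -> 0 < u t x.

(** The primitive of [u] vanishing at [0], written through [dx v] so that its joint continuity is
    inherited from [v]. *)
Definition mass_fun (s x : R) : R := M * x - dx v s x.
(** Its space derivative is [dt u], and it turns out to be the time derivative of [mass_fun]. *)
Definition flux (t x : R) : R := a (u t x) * dx u t x - u t x * dx v t x.

Let cylP t x : 0 < t -> (t%:E < T)%E -> 0 <= x <= 1 -> cyl_pos T (t, x).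
Proof. by []. Qed.

Lemma solution_u_gt0 t x : 0 < t -> (t%:E < T)%E -> 0 <= x <= 1 -> 0 < u t x.
Proof. by move=> t0 tT x01; apply: u_gt0; split => //; exact: ltW. Qed.

Lemma is_derive01_u t x : 0 < t -> (t%:E < T)%E -> 0 <= x <= 1 ->
  is_derive01 (u t) x (dx u t x).
Proof.
move=> t0 tT x01; apply: derivable01P.
by case: (sol_C12_u sol) => /(_ t x (cylP t0 tT x01))[].
Qed.

Lemma is_derive01_v t x : 0 < t -> (t%:E < T)%E -> 0 <= x <= 1 ->
  is_derive01 (v t) x (dx v t x).
Proof.
move=> t0 tT x01; apply: derivable01P.
by case: (sol_C12_v sol) => /(_ t x (cylP t0 tT x01))[].
Qed.

Lemma is_derive_ux t x : 0 < t -> (t%:E < T)%E -> 0 < x < 1 ->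
  is_derive x 1 (dx u t) (dx (dx u) t x).
Proof.
move=> t0 tT /[dup] x01 /andP[? ?]; apply: is_derive01_is_derive => //.
apply: derivable01P; case: (sol_C12_u sol) => /(_ t x)[] //.
by apply: cylP => //; apply/andP; split; exact: ltW.
Qed.

(** The equation for [v] is given only at interior points; continuity of both sides extends it to
    the end points. *)
Lemma is_derive01_mass_fun t x : 0 < t -> (t%:E < T)%E -> 0 <= x <= 1 ->
  is_derive01 (mass_fun t) x (u t x).
Proof.
move=> t0 tT x01.
have Ct y : 0 <= y <= 1 -> cyl_pos T (t, y) by exact: cylP.
case: (sol_C12_v sol) => dv _ _ _ cvxx.
case: (sol_C12_u sol) => _ cu _ _ _.
pose g y := dx (dx v) t y + u t y - M.
have cg : {within `[0, 1], continuous g}.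
  apply: within_continuousB; last exact: within_continuous_cst.
  by apply: within_continuousD; apply: continuous_on2_slice Ct.
have g0 y : 0 < y < 1 -> g y = 0.
  by move=> y01; rewrite /g -(sol_eq_v sol t0 tT y01).
have gx : g x = 0.
  apply/eqP; rewrite eq_le; apply/andP; split.
    by apply: le0_closure01 x01 => // y /g0 ->.
  rewrite -oppr_le0; apply: (@le0_closure01 _ (\- g)) x01 => [y|y /g0 /= ->].
    by apply: continuousN; exact: cg.
  by rewrite oppr0.
have [_ _ /derivable01P H] := dv t x (Ct x x01).
move=> e /H[d d0 Hd]; exists d => // y y01 yd.
apply: le_trans (Hd y y01 yd).
have -> : mass_fun t y - mass_fun t x - u t x * (y - x) =
    - (dx v t y - dx v t x - (M - u t x) * (y - x)) by rewrite /mass_fun; ring.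
rewrite normrN.
rewrite (_ : M - u t x = derive01 (dx v t) x)//.
by move: gx; rewrite /g /dx => /eqP; rewrite subr_eq0 => /eqP <-; rewrite addrK.
Qed.

Lemma mass_fun0 t : 0 < t -> (t%:E < T)%E -> mass_fun t 0 = 0.
Proof.
move=> t0 tT; rewrite /mass_fun; have [-> _] := sol_bc_v sol t0 tT.
by rewrite mulr0 subr0.
Qed.

Lemma mass_fun1 t : 0 < t -> (t%:E < T)%E -> mass_fun t 1 = M.
Proof.
move=> t0 tT; rewrite /mass_fun; have [_ ->] := sol_bc_v sol t0 tT.
by rewrite mulr1 subr0.
Qed.

(** The chain rule at the end points identifies the derivative of [A(u)] with [a(u) dx u]; the drift
    part vanishes with [dx v]. *)
Lemma flux_bc t : 0 < t -> (t%:E < T)%E -> flux t 0 = 0 /\ flux t 1 = 0.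
Proof.
move=> t0 tT; have [v0 v1] := sol_bc_v sol t0 tT.
have [A0 A1] := sol_bc_u sol t0 tT.
have H x : 0 <= x <= 1 -> dx (fun s y => A (u s y)) t x = a (u t x) * dx u t x.
  move=> x01; apply: is_derive01_val => //.
  apply: (@is_derive01_comp _ A (u t)); last exact: is_derive01_u.
  by apply: dA; exact: solution_u_gt0.
by rewrite /flux v0 v1 -!H ?A0 ?A1 ?mulr0 ?subrr ?lexx ?ler01.
Qed.

Lemma continuous_flux t : 0 < t -> (t%:E < T)%E ->
  {within `[0, 1], continuous (flux t)}.
Proof.
move=> t0 tT; have Ct y : 0 <= y <= 1 -> cyl_pos T (t, y) by exact: cylP.
case: (sol_C12_u sol) => _ cu _ cux _.
case: (sol_C12_v sol) => _ _ _ cvx _.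
have cut := continuous_on2_slice cu Ct.
have ca : {within `[0, 1], continuous (fun x => a (u t x))}.
  apply: (within_continuous_postcomp cut) => x; rewrite /= in_itv /= => x01.
  have [da _] := aC1 (solution_u_gt0 t0 tT x01).
  exact/differentiable_continuous/derivable1_diffP.
by apply: within_continuousB; apply: within_continuousM => //;
  apply: continuous_on2_slice Ct.
Qed.

(** The equation supplies only the value of [derive01]; differentiability comes from the product and
    chain rules. *)
Lemma is_derive_flux t x : 0 < t -> (t%:E < T)%E -> 0 < x < 1 ->
  is_derive x 1 (flux t) (dt u t x).
Proof.
move=> t0 tT /[dup] x01 /andP[x0 x1].
have x01' : 0 <= x <= 1 by rewrite !ltW.
have du := is_derive01_is_derive x01 (is_derive01_u t0 tT x01').
have [da _] := aC1 (solution_u_gt0 t0 tT x01').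
have dau := @is_derive1_comp _ a (u t) x _ _ (derivableP da) du.
have duxx := is_derive_ux t0 tT x01.
have dvx : is_derive x 1 (dx v t) (dx (dx v) t x).
  apply: is_derive01_is_derive => //; apply: derivable01P.
  by case: (sol_C12_v sol) => /(_ t x (cylP t0 tT x01'))[].
have H := is_deriveB (is_deriveM dau duxx) (is_deriveM du dvx).
rewrite (sol_eq_u sol t0 tT x01); apply: (is_derive_eq H).
by apply/esym/is_derive01_val => //; exact: is_derive_is_derive01.
Qed.

(** [C12] provides no time derivative of [dx v]. It is recovered by integrating [dt u = dx flux] in
    space, the flux being zero at [0]. *)
Lemma is_derive_time_mass_fun t x : 0 < t -> (t%:E < T)%E -> 0 <= x <= 1 ->
  is_derive t 1 (mass_fun^~ x) (flux t x).
Proof.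
move=> t0 tT x01; have [t1 tt1 t1T] := lt_ereal_between tT.
have sT s : 0 < s < t1 -> 0 < s /\ (s%:E < T)%E.
  by move=> /andP[s0 st]; split=> //; apply: lt_trans t1T; rewrite lte_fin.
case: (sol_C12_u sol) => du _ cut _ _.
apply: (@is_derive_time_primitive _ 0 t1 t mass_fun u (dt u) (flux t)) => //.
- by rewrite t0.
- by move=> s y /sT[s0 s1] y01; exact: is_derive01_mass_fun.
- move=> s y /sT[s0 s1] y01; have [dus _ _] := du s y (cylP s0 s1 y01).
  by rewrite /dt derive1E; exact: derivableP.
- apply: continuous_subspaceW cut => -[s y] /= [/sT[s0 s1] y01]; exact: cylP.
- by move=> y; exact: is_derive_flux.
- exact: continuous_flux.
- by have [] := flux_bc t0 tT.
- by move=> s /sT[s0 s1]; exact: mass_fun0.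
Qed.

Lemma mass_fun_bounds t x : 0 < t -> (t%:E < T)%E -> 0 <= x <= 1 ->
  0 <= mass_fun t x <= M.
Proof.
move=> t0 tT /andP[x0 x1].
have mono := @is_derive01_ge0_nondecreasing _ _ _
  (fun y => is_derive01_mass_fun t0 tT)
  (fun y y01 => ltW (solution_u_gt0 t0 tT y01)).
rewrite -{1}(mass_fun0 t0 tT) -(mass_fun1 t0 tT).
by rewrite !mono ?lexx ?x0 ?x1.
Qed.

Lemma continuous_on2_mass_fun t0 t1 : 0 < t0 -> (t1%:E < T)%E ->
  continuous_on2 [set q | t0 <= q.1 <= t1 /\ 0 <= q.2 <= 1] mass_fun.
Proof.
move=> t00 t1T; case: (sol_C12_v sol) => _ _ _ cvx _.
apply: within_continuousB.
  apply: within_continuousM; first exact: within_continuous_cst.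
  by apply: continuous_subspaceT => q; exact: cvg_snd.
apply: continuous_subspaceW cvx => -[s y] /= [/andP[s0 s1] y01].
apply: cylP => //; first exact: lt_le_trans s0.
by apply: le_lt_trans t1T; rewrite lee_fin.
Qed.

(** An upper bound for [sg = 1] and a lower bound for [sg = -1], both equal to the barrier value
    [p 0]. The positive starting time gives access to the [C12] regularity. *)
Lemma solution_comparison (sg K t0 : R) :
  (sg = 1 \/ sg = -1) -> 0 < K -> 0 <= sg * (K - M) ->
  (forall s, 0 <= sg * (s - A K) -> exists2 r, 0 < r & A r = s) ->
  0 < t0 -> (t0%:E < T)%E ->
  (forall x, 0 <= x <= 1 -> sg * (u t0 x - K) <= 0) ->
  exists2 B, 0 < B & forall t x, t0 <= t -> (t%:E < T)%E -> 0 <= x <= 1 ->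
    sg * (u t x - B) <= 0.
Proof.
move=> sg1 K0 KM surj t00 t0T uK.
(* The barrier constant [M + 1] strictly dominates the drift factor, bounded by [M]. *)
have MC : M < M + 1 by rewrite ltrDl.
have C0 : 0 < M + 1 by rewrite addr_gt0.
have [p [G [p_gt0 dG dp G0 GK]]] :=
  exists_barrier sg1 K0 M_gt0 C0 a_gt0 dA surj.
have M00 : 0 <= (0 : R) <= M by rewrite lexx ltW.
have M0M : 0 <= M <= M by rewrite lexx ltW.
exists (p 0); first exact: p_gt0.
move=> t x t0t tT.
have sT s : t0 <= s <= t -> 0 < s /\ (s%:E < T)%E.
  move=> /andP[s0 st]; split; first exact: lt_le_trans s0.
  by apply: le_lt_trans tT; rewrite lee_fin.
have GM : sg * (G M - 1) <= 0.
  have -> : sg * (G M - 1) = sg * (G M - M / K) - sg * (K - M) / K.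
    by field; rewrite gt_eqF.
  by rewrite subr_le0; apply: le_trans (GK M M0M) _; rewrite divr_ge0// ltW.
(* At time [t0] the mean value theorem compares the increment with [K * (x' - y')], and [GK]
   compares [G] with division by [K]. *)
have init x' y' : 0 <= y' <= x' -> x' <= 1 ->
    sg * (G (mass_fun t0 x' - mass_fun t0 y') - (x' - y')) <= 0.
  move=> /andP[y0 yx] x1.
  have dU z : 0 <= z <= 1 -> is_derive01 (mass_fun t0) z (u t0 z).
    by move=> z01; exact: is_derive01_mass_fun.
  have mono := @is_derive01_ge0_nondecreasing _ _ _ dU
    (fun y y01 => ltW (solution_u_gt0 t00 t0T y01)).
  set D := mass_fun t0 x' - mass_fun t0 y'.
  have D0M : 0 <= D <= M.
    rewrite subr_ge0 mono ?y0//= lerBlDr.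
    have /andP[_ h1] : 0 <= mass_fun t0 x' <= M.
      by apply: mass_fun_bounds; rewrite // x1 (le_trans y0 yx).
    have /andP[h2 _] : 0 <= mass_fun t0 y' <= M.
      by apply: mass_fun_bounds; rewrite // y0 (le_trans yx x1).
    by apply: le_trans h1 _; rewrite lerDl.
  have DK : sg * (D - K * (x' - y')) <= 0.
    have [|||c] := @MVT_segment _ (mass_fun t0) (u t0) y' x' => //.
    - move=> z; rewrite in_itv /= => /andP[z0 z1].
      have z01 : 0 < z < 1.
        by rewrite (le_lt_trans y0 z0) (lt_le_trans z1 x1).
      by apply: is_derive01_is_derive => //; apply: dU; rewrite !ltW; case/andP: z01.
    - apply: continuous_subspaceW (is_derive01_within_continuous dU).
      move=> z /=; rewrite !in_itv /= => /andP[z0 z1].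
      by rewrite (le_trans y0 z0) (le_trans z1 x1).
    rewrite in_itv /= => /andP[c0 c1] E.
    rewrite /D E -mulrBl mulrA; apply: mulr_le0_ge0; last by rewrite subr_ge0.
    by apply: uK; rewrite (le_trans y0 c0) (le_trans c1 x1).
  have -> : sg * (G D - (x' - y')) =
      sg * (G D - D / K) + sg * (D - K * (x' - y')) / K.
    by field; rewrite gt_eqF.
  rewrite -[leRHS]addr0 lerD ?GK//.
  by apply: mulr_le0_ge0 => //; rewrite invr_ge0 ltW.
have tt : t0 <= t <= t by rewrite t0t lexx.
have cmp := @doubling_comparison _ sg M (M + 1) t0 t a p G mass_fun u (dx u) flux
  sg1 t0t MC a_gt0 p_gt0 dG dp G0 GM.
have {}cmp x' y' : 0 <= y' <= x' -> x' <= 1 ->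
    sg * (G (mass_fun t x' - mass_fun t y') - (x' - y')) <= 0.
  apply: cmp => //.
  - exact: continuous_on2_mass_fun.
  - by move=> s /sT[s0 s1]; rewrite mass_fun0 ?mass_fun1.
  - move=> s y /sT[s0 s1] y01; split; first exact: solution_u_gt0.
    exact: is_derive01_mass_fun.
  - move=> s y /sT[s0 s1] /[dup] y01 /andP[? ?]; apply: is_derive01_is_derive => //.
    by apply: is_derive01_u => //; rewrite !ltW.
  - by move=> s y /sT[s0 s1]; exact: is_derive_time_mass_fun.
  - by move=> s /sT[s0 s1]; exact: flux_bc.
  - by move=> s y _ _; rewrite /flux /mass_fun opprB addrCA subrr addr0.
have [t_gt0 _] := sT t tt.
apply: (@le0_closure01 _ (fun x => sg * (u t x - p 0))).
  apply: within_continuousM; first exact: within_continuous_cst.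
  apply: within_continuousB; last exact: within_continuous_cst.
  exact: (is_derive01_within_continuous (fun y => @is_derive01_u t y t_gt0 tT)).
move=> y /andP[y0 y1]; have y01 : 0 <= y <= 1 by rewrite !ltW.
(* The comparison function vanishes at [x = y], so its right derivative in [x]
   there is nonpositive. *)
have p00 := p_gt0 0 M00.
have dUy : is_derive y 1 (mass_fun t) (u t y).
  by apply: is_derive01_is_derive; [rewrite y0|exact: is_derive01_mass_fun].
(* Reflection turns the right derivative at [y] into a left derivative at [- y], as
   [derive_left_max_ge0] requires. *)
have dUr : is_derive (- (- y)) 1 (fun x => mass_fun t x - mass_fun t y) (u t y).
  rewrite opprK.
  have H := is_deriveB dUy (is_derive_cst (mass_fun t y) y 1).
  by apply: (is_derive_eq H); rewrite subr0.
have dG0 : is_derive (mass_fun t (- (- y)) - mass_fun t y) 1 G (p 0)^-1.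
  by rewrite opprK subrr; exact: dG.
have dN : is_derive (- y) 1 (fun z : R => - z) (-1) by exact: is_deriveNid.
have H1 := @is_derive1_comp _ G (fun x => mass_fun t x - mass_fun t y) _ _ _ dG0 dUr.
have H2 := @is_derive1_comp _ (fun x => G (mass_fun t x - mass_fun t y)) -%R
  (- y) _ _ H1 dN.
have H3 := is_deriveZ sg (is_deriveB H2 (is_deriveB dN (is_derive_cst y (- y) 1))).
have := @derive_left_max_ge0 _ _ (- 1) (- y) _ _ H3.
rewrite ltrN2 => /(_ y1).
have -> : sg *: ((p 0)^-1 * u t y * -1 - (-1 - 0)) = - (sg * (u t y - p 0) / p 0).
  by rewrite /GRing.scale /=; field; rewrite gt_eqF.
rewrite oppr_ge0 pmulr_lle0 ?invr_gt0//; apply => z /andP[z1 zy].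
suff : sg * (G (mass_fun t (- z) - mass_fun t y) - (- z - y)) <=
    sg * (G (mass_fun t (- - y) - mass_fun t y) - (- - y - y)) by [].
rewrite (opprK y) (subrr (mass_fun t y)) G0 (subrr y) subrr mulr0.
apply: cmp; last by rewrite lerNl.
by rewrite ltW//= lerNr.
Qed.

End SolutionFacts.

(** * Means, sup norms and compact time intervals *)

Lemma Rintegral_cst01 (R : realType) (c : R) :
  \int[lebesgue_measure]_(_ in `[0, 1]) c = c.
Proof.
have mI : measurable (`[0, 1]%classic : set (measurableTypeR R)).
  exact: measurable_itv.
have I01 : (@lebesgue_measure R `[0%R, 1%R]%classic = 1)%E.
  by rewrite lebesgue_measure_itv /= lte_fin ltr01 oppr0 adde0.
by rewrite Rintegral_cst// [X in fine X](_ : _ = 1%E) ?mulr1//; exact: I01.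
Qed.

Lemma mean01_ge (R : realType) (f : R -> R) (c : R) :
  {within `[0, 1], continuous f} -> (forall x, 0 <= x <= 1 -> c <= f x) ->
  c <= mean 0 1 f.
Proof.
move=> cf fc; rewrite /mean subr0 invr1 mul1r.
have mI : measurable (`[0, 1]%classic : set (measurableTypeR R)).
  exact: measurable_itv.
apply: le_trans (_ : \int[@lebesgue_measure R]_(_ in `[0, 1]) c <= _).
  by rewrite Rintegral_cst01.
apply: le_Rintegral => //.
- apply: continuous_compact_integrable; first exact: segment_compact.
  exact: within_continuous_cst.
- by apply: continuous_compact_integrable; first exact: segment_compact.
Qed.

Lemma mean01_le (R : realType) (f : R -> R) (c : R) :
  {within `[0, 1], continuous f} -> (forall x, 0 <= x <= 1 -> f x <= c) ->
  mean 0 1 f <= c.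
Proof.
move=> cf fc; rewrite /mean subr0 invr1 mul1r.
have mI : measurable (`[0, 1]%classic : set (measurableTypeR R)).
  exact: measurable_itv.
apply: le_trans (_ : _ <= \int[@lebesgue_measure R]_(_ in `[0, 1]) c) _; last first.
  by rewrite Rintegral_cst01.
apply: le_Rintegral => //.
- by apply: continuous_compact_integrable; first exact: segment_compact.
- apply: continuous_compact_integrable; first exact: segment_compact.
  exact: within_continuous_cst.
Qed.

(** On an interval of length 1, [f] stays within [L] of [f x]; hence so does its mean, which is
    zero. *)
Lemma mean0_lipschitz_bound (R : realType) (f df : R -> R) (L : R) :
  (forall x, 0 <= x <= 1 -> is_derive01 f x (df x)) ->
  (forall x, 0 <= x <= 1 -> `|df x| <= L) -> mean 0 1 f = 0 ->
  forall x, 0 <= x <= 1 -> `|f x| <= L.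
Proof.
move=> dfE dfL f0 x x01; have cf := is_derive01_within_continuous dfE.
have L0 : 0 <= L by apply: le_trans (dfL x x01).
have lip y : 0 <= y <= 1 -> `|f y - f x| <= L.
  move=> y01; wlog : x y x01 y01 / x <= y.
    move=> W; have [/W|/ltW/W] := leP x y; first exact.
    by rewrite distrC; exact.
  move=> xy; case/andP: x01 => x0 x1; case/andP: y01 => y0 y1.
  have [||c] := @MVT_segment _ f df x y xy.
  - move=> z; rewrite in_itv /= => /andP[xz zy].
    have z0 : 0 < z := le_lt_trans x0 xz.
    have z1 : z < 1 := lt_le_trans zy y1.
    by apply: is_derive01_is_derive; [rewrite z0|apply: dfE; rewrite !ltW].
  - apply: continuous_subspaceW cf => z /=; rewrite !in_itv /= => /andP[xz zy].
    by rewrite (le_trans x0 xz) (le_trans zy y1).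
  rewrite in_itv /= => /andP[xc cy] ->; rewrite normrM.
  have c01 : 0 <= c <= 1 by rewrite (le_trans x0 xc) (le_trans cy y1).
  rewrite (ger0_norm (_ : 0 <= y - x)) ?subr_ge0//.
  apply: le_trans (ler_wpM2r _ (dfL c c01)) _; first by rewrite subr_ge0.
  by rewrite ler_piMr// lerBlDr (le_trans y1)// lerDl.
rewrite ler_norml; apply/andP; split.
- have := @mean01_le _ f (f x + L) cf; rewrite f0 -lerBlDr sub0r; apply=> y y01.
  by rewrite -lerBlDl; exact: le_trans (ler_norm _) (lip y y01).
- have := @mean01_ge _ f (f x - L) cf; rewrite f0 subr_le0; apply=> y y01.
  rewrite lerBlDr -lerBlDl -opprB lerNl.
  by have := lip y y01; rewrite ler_norml => /andP[].
Qed.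

Lemma Linf01_le (R : realType) (V : normedModType R) (f : R -> V) (C : R) :
  (forall x, 0 <= x <= 1 -> `|f x| <= C) -> (Linf01 f <= C%:E)%E.
Proof.
(* Needed because the function is extended by zero outside []0, 1[]. *)
move=> fC; have C0 : 0 <= C.
  by apply: le_trans (fC 0 _); rewrite // lexx ler01.
rewrite /Linf01 unlock; case: ifP => _; last by rewrite lee_fin.
apply/ess_supP; apply: nearW => x /=; rewrite patchE; case: ifPn => [|_].
  rewrite inE /= in_itv /= => /andP[x0 x1].
  by rewrite lee_fin normr_id fC// !ltW.
by rewrite abse0 lee_fin.
Qed.

Lemma continuous_on2_bounded (R : realType) (D : set (R * R)) (w : R -> R -> R)
    (t0 t1 : R) : continuous_on2 D w -> t0 <= t1 ->
  (forall t x, t0 <= t <= t1 -> 0 <= x <= 1 -> D (t, x)) ->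
  exists B, forall t x, t0 <= t <= t1 -> 0 <= x <= 1 -> w t x <= B.
Proof.
move=> cw t01 sub; pose K : set (R * R) := `[t0, t1] `*` `[0, 1].
have Kn0 : K !=set0.
  by exists (t0, 0); split; rewrite /= in_itv /= lexx ?t01 ?ler01.
have cK : compact K by apply: compact_setX; exact: segment_compact.
have cwK : {within K, continuous (fun q : R * R => w q.1 q.2)}.
  apply: continuous_subspaceW cw => -[t x] [] /=; rewrite !in_itv /=.
  exact: sub.
have [c _ cmax] := compact_EVT_max Kn0 cK cwK.
exists (w c.1 c.2) => t x tT x01; apply: (cmax (t, x)).
by rewrite inE; split; rewrite /= in_itv.
Qed.

(** * Range of the primitive of [a] *)

Lemma intermediate_value_pos (R : realType) (a A : R -> R) (x y s : R) :
  (forall r : R, 0 < r -> is_derive r 1 A (a r)) -> 0 < x -> x <= y ->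
  A x <= s <= A y -> exists2 r, 0 < r & A r = s.
Proof.
move=> dA x0 xy sA.
have [||c] := @IVT R A x y s xy.
- apply: derivable_within_continuous => z; rewrite in_itv /= => /andP[xz _].
  by case: (dA z (lt_le_trans x0 xz)).
- case/andP: sA => h1 h2.
  have h3 := le_trans h1 h2.
  by rewrite (min_idPl h3) (max_idPr h3) h1.
rewrite in_itv /= => /andP[xc _] <-; exists c => //; exact: lt_le_trans xc.
Qed.

(** Exhausting by [[1, n + 2]], nondegenerate already for [n = 0], gives [A (n + 2) > s]; the
    intermediate value theorem between [K] and [n + 2] concludes. *)
Lemma primitive_surj_at_pinfty (R : realType) (a A : R -> R) (K s : R) :
  C1_pos a -> (forall r : R, 0 < r -> 0 < a r) ->
  (forall r : R, 0 < r -> is_derive r 1 A (a r)) ->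
  ~ L1_on `]1, +oo[ a -> 0 < K -> A K <= s -> exists2 r, 0 < r & A r = s.
Proof.
move=> aC1 a0 dA nL1 K0 Ks.
have [||||n] := @nonintegrable_primitive_unbounded _ a A _
  (fun=> 1) (fun n => n%:R + 2) (s - A 1) aC1 a0 dA (measurable_itv _) _ _ _ _ nL1.
- by move=> n; rewrite ltr01 /= ltr_wpDl// ltr1n.
- by [].
- by move=> n; rewrite lerD2r ler_nat.
- move=> x; rewrite /= in_itv /= andbT => x1.
  exists (Num.truncn x); rewrite ltW//=.
  have x0 : 0 <= x by rewrite (le_trans _ (ltW x1)).
  have /andP[_ /ltW h] := truncn_itv x0; rewrite (le_trans h)//.
  by rewrite -addn1 natrD lerD2l ler1n.
rewrite ltrD2r => sn; have n0 : (0 : R) < n%:R + 2 by rewrite ltr_wpDl.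
have Kn : K < n%:R + 2.
  rewrite ltNge; apply/negP; rewrite le_eqVlt => /predU1P[E|h].
    by move: sn; rewrite E ltNge Ks.
  have := lt_trans (primitive_increasing a0 dA n0 h) (le_lt_trans Ks sn).
  by rewrite ltxx.
by apply: (intermediate_value_pos dA K0 (ltW Kn)); rewrite Ks ltW.
Qed.

(** The same argument with the intervals [[1 / (n + 2), 1]], which reach down to zero. *)
Lemma primitive_surj_at_0 (R : realType) (a A : R -> R) (K s : R) :
  C1_pos a -> (forall r : R, 0 < r -> 0 < a r) ->
  (forall r : R, 0 < r -> is_derive r 1 A (a r)) ->
  ~ L1_on `]0, 1[ a -> 0 < K -> s <= A K -> exists2 r, 0 < r & A r = s.
Proof.
move=> aC1 a0 dA nL1 K0 Ks.
have pos n : (0 : R) < n%:R + 2 by rewrite ltr_wpDl.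
have [||||n] := @nonintegrable_primitive_unbounded _ a A _
  (fun n => (n%:R + 2)^-1) (fun=> 1) (A 1 - s) aC1 a0 dA (measurable_itv _) _ _ _ _ nL1.
- move=> n; rewrite invr_gt0 pos /= invf_lt1//.
  by rewrite ltr_wpDl// ltr1n.
- by move=> n; rewrite lef_pV2 ?posrE// lerD2r ler_nat.
- by [].
- move=> x; rewrite /= in_itv /= => /andP[x0 /ltW ->].
  exists (Num.truncn x^-1); rewrite andbT invf_ple ?posrE//.
  have x0' : 0 <= x^-1 by rewrite invr_ge0 ltW.
  have /andP[_ /ltW h] := truncn_itv x0'; rewrite (le_trans h)//.
  by rewrite -addn1 natrD lerD2l ler1n.
rewrite ltrD2l ltrN2 => sn; have n0 : (0 : R) < (n%:R + 2)^-1 by rewrite invr_gt0.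
have nK : (n%:R + 2)^-1 < K.
  rewrite ltNge; apply/negP; rewrite le_eqVlt => /predU1P[E|h].
    by move: sn; rewrite -E ltNge Ks.
  have := lt_trans (primitive_increasing a0 dA K0 h) (lt_le_trans sn Ks).
  by rewrite ltxx.
by apply: (intermediate_value_pos dA n0 (ltW nK)); rewrite Ks ltW.
Qed.

(** * Global existence, boundedness and positivity *)

Theorem theorem7 (R : realType) (a A u0 : R -> R) (M m0 : R)
    (u v : R -> R -> R) (Tmax : \bar R)
  (a_C1 : C1_pos a)
  (a_gt0 : forall r : R, 0 < r -> 0 < a r)
  (a_notL1 : ~ L1_on `]1, +oo[ a)
  (a_kappa : forall eps : R, 0 < eps -> exists2 kappa : R, 0 < kappa &
     forall r : R, 0 < r < 1 -> a r <= eps * r * a r + kappa / r)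
  (A_prim : forall r : R, 0 < r -> is_derive r 1 A (a r))
  (M_gt0 : 0 < M) (m0_bnd : 0 < m0 < M)
  (u0_cont : {within `[0, 1], continuous u0})
  (u0_ge : forall x : R, 0 <= x <= 1 -> m0 <= u0 x)
  (u0_mean : mean 0 1 u0 = M)
  (uv_sol : maximal_classical_solution a A u0 M m0 Tmax u v) :
  [/\ Tmax = +oo%E,
      exists C : R, forall t : R, 0 <= t ->
        (Linf01 (fun x : R => (u t x, v t x)) <= C%:E)%E
    & ~ L1_on `]0, 1[ a ->
      exists2 mu : R, 0 < mu &
        forall t x : R, 0 <= t -> 0 <= x <= 1 -> mu <= u t x].
Proof.
case: uv_sol => T_gt0 sol _ lower blowup.
case/andP: m0_bnd => m00 m0M.
have u_gt0 t x : cyl Tmax (t, x) -> 0 < u t x.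
  move=> /lower; apply: lt_le_trans; rewrite divr_gt0 ?mulr_gt0//.
  by rewrite addr_gt0// mulr_gt0 ?expR_gt0// subr_gt0.
(* On [[0, t0]] compactness bounds [u]; from the positive time [t0] on, the comparison applies. *)
have [t0 t00 t0T] := lt_ereal_between T_gt0.
have t0T' t : 0 <= t <= t0 -> (t%:E < Tmax)%E.
  by move=> /andP[_ h]; apply: le_lt_trans t0T; rewrite lee_fin.
have cylt0 t x : 0 <= t <= t0 -> 0 <= x <= 1 -> cyl Tmax (t, x).
  by move=> /[dup] /t0T' tT /andP[h _].
have [B0 uB0] := continuous_on2_bounded (sol_cont_u sol) (ltW t00) cylt0.
(* Above [u t0] and at least [M], as the comparison with [sg = 1] demands. *)
pose K := Num.max B0 M.
have K0 : 0 < K by rewrite lt_max M_gt0 orbT.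
have [||||B B_gt0 uB] := solution_comparison a_C1 a_gt0 A_prim M_gt0 sol u_gt0
  (sg := 1) (K := K) (t0 := t0) _ K0 _ _ t00 t0T.
- by left.
- by rewrite mul1r subr_ge0 le_max lexx orbT.
- move=> s; rewrite mul1r subr_ge0.
  exact: primitive_surj_at_pinfty.
- move=> x x01; rewrite mul1r subr_le0 le_max uB0//.
  by rewrite ltW//= lexx.
pose C := Num.max (Num.max B0 B) M.
have uC t x : 0 <= t -> (t%:E < Tmax)%E -> 0 <= x <= 1 -> `|u t x| <= C.
  move=> h0 tT x01; rewrite ger0_norm; last by rewrite ltW// u_gt0.
  rewrite !le_max; have [tle|/ltW tge] := leP t t0.
    by rewrite uB0 ?h0.
  by have := uB t x tge tT x01; rewrite mul1r subr_le0 => ->; rewrite orbT.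
(* A finite [Tmax] would make the sup norm exceed the uniform bound [C] at some earlier time. *)
have Toy : Tmax = +oo%E.
  case ET : Tmax T_gt0 => [T0||]; [|by []|by rewrite ltNge leNye].
  rewrite lte_fin => T00; have := blowup T0 ET => /cvgey_gt/(_ C) nC.
  have [t [[+ t_gt0] tlt]] : exists t, ((C%:E < Linf01 (u t))%E /\ 0 < t) /\ t < T0.
    apply: (@filter_ex _ (T0^'-)); apply: filterI; last exact: nbhs_left_lt.
    by apply: filterI => //; exact: nbhs_left_gt.
  rewrite ltNge => /negP[]; apply: Linf01_le => x x01.
  by apply: uC => //; [exact: ltW|rewrite ET lte_fin].
have tT t : (t%:E < Tmax)%E by rewrite Toy ltry.
(* [dx v] is the difference of [M * y] and the cumulative mass, both in [0, M], and [v t] has mean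
   zero. *)
have vM t x : 0 < t -> 0 <= x <= 1 -> `|v t x| <= M.
  move=> t_gt0 x01.
  apply: (@mean0_lipschitz_bound _ (v t) (dx v t)) => //;
    last exact: sol_mean_v sol _ _ (tT t).
    by move=> y y01; exact: (is_derive01_v sol).
  move=> y y01.
  have /andP[h1 h2] := mass_fun_bounds sol u_gt0 t_gt0 (tT t) y01.
  rewrite (_ : dx v t y = M * y - mass_fun M v t y); last by rewrite /mass_fun; ring.
  by case/andP: y01 => y0 y1; rewrite ler_norml; apply/andP; split; nra.
(* At [t = 0] the bound is inherited from small positive times by continuity. *)
have vM0 t x : 0 <= t -> 0 <= x <= 1 -> `|v t x| <= M.
  rewrite le_eqVlt => /predU1P[<- x01|]; last exact: vM.
  rewrite leNgt; apply/negP => vgt.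
  have e0 : 0 < `|v 0 x| - M by rewrite subr_gt0.
  have [//|d d0 Hd] := continuous_on2_dist (sol_cont_v sol) (_ : cyl Tmax (0, x)) e0.
  have d2 : 0 < d / 2 by rewrite divr_gt0.
  have := Hd (d / 2) x _ _ _; rewrite !subrr normr0 subr0 gtr0_norm//.
  rewrite ltr_pdivrMr// ltr_pMr// ltr1n => /(_ _ isT d0) h.
  have {}h := h (And3 (ltW d2) (tT _) x01).
  have := lerB_dist (v 0 x) (v (d / 2) x); have := vM (d / 2) x d2 x01.
  rewrite distrC in h; move=> ? ?; lra.
split => //.
- exists C => t t_ge0; apply: Linf01_le => x x01.
  rewrite prod_normE ge_max uC//= /C le_max vM0 ?orbT//.
- move=> nL1.
  (* This a priori bound decreases in time, so [l t0] serves on all of [[0, t0]]. *)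
  pose l t := M * m0 / (m0 + expR (M * t) * (M - m0)).
  have den_gt0 t : 0 < m0 + expR (M * t) * (M - m0).
    by rewrite addr_gt0// mulr_gt0 ?expR_gt0// subr_gt0.
  have l_gt0 : 0 < l t0 by rewrite divr_gt0 ?mulr_gt0.
  have ul t x : 0 <= t <= t0 -> 0 <= x <= 1 -> l t0 <= u t x.
    move=> tt0 x01; apply: le_trans (lower t x (cylt0 t x tt0 x01)).
    rewrite ler_pM2l ?mulr_gt0// lef_pV2 ?posrE// lerD2l ler_pM2r ?subr_gt0//.
    by rewrite ler_expR ler_pM2l//; case/andP: tt0.
  have K1_gt0 : 0 < Num.min (l t0) M by rewrite lt_min l_gt0.
  have [||||B1 B1_gt0 uB1] := solution_comparison a_C1 a_gt0 A_prim M_gt0 sol u_gt0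
    (sg := -1) (K := Num.min (l t0) M) (t0 := t0) _ K1_gt0 _ _ t00 t0T.
  + by right.
  + by rewrite mulN1r oppr_ge0 subr_le0 ge_min lexx orbT.
  + move=> s; rewrite mulN1r oppr_ge0 subr_le0.
    exact: primitive_surj_at_0.
  + move=> x x01; rewrite mulN1r oppr_le0 subr_ge0 ge_min ul//.
    by rewrite (ltW t00) lexx.
  exists (Num.min (l t0) B1); first by rewrite lt_min l_gt0.
  move=> t x t_ge0 x01; rewrite ge_min; have [tle|/ltW tge] := leP t t0.
    by rewrite ul// t_ge0.
  by have := uB1 t x tge (tT t) x01; rewrite mulN1r oppr_le0 subr_ge0 => ->; rewrite orbT.
Qed.
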